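(* Let $m\ge1$, $0=c_1<c_2<\cdots<c_m$ be fixed, and for $x\in\mathbb{R}$ let $\vec t=(t_1,\dots,t_m)=(x,c_2+x,\dots,c_m+x)$. Let $\hat\omega_0:=1$ and $\hat\omega_1,\dots,\hat\omega_m\ge0$, let $\omega_k:=\hat\omega_k-\hat\omega_{k-1}$ ($k=1,\dots,m$), and consider the weight $w(s)={\rm e}^{-s^2}\big(1+\sum_{k=1}^m\omega_k\theta(s-t_k)\big)$ on $\mathbb{R}$. Let $n\ge1$, and let $a_k(x),b_k(x)$ ($k=1,\dots,m$) be the functions defined in the context from the Lax matrix of the associated Riemann–Hilbert problem. Then for $k=1,\dots,m$, $$R_{n,k}(\vec t)=\frac{a_kb_k^2}{\sum_{j=1}^ma_jb_j+n},\qquad r_{n,k}(\vec t)=a_kb_k,$$ equivalently (when the denominators are nonzero) $$a_k=\frac{r_{n,k}^2}{R_{n,k}\big(\sum_{j=1}^mr_{n,j}+n\big)},\qquad b_k=\frac{R_{n,k}}{r_{n,k}}\Big(\sum_{j=1}^mr_{n,j}+n\Big),$$ and moreover $a_k(x)=\frac12R_{n-1,k}(\vec t)$.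
   Context: $\theta(y)=1$ for $y>0$ and $0$ otherwise. $P_j(z)$ is the monic degree-$j$ polynomial orthogonal w.r.t. $w$ on $\mathbb{R}$, $\int P_jP_kw\,ds=h_k\delta_{jk}$, $h_k>0$. $R_{j,k}:=\omega_k{\rm e}^{-t_k^2}P_j(t_k)^2/h_j$ and $r_{n,k}:=\omega_k{\rm e}^{-t_k^2}P_n(t_k)P_{n-1}(t_k)/h_{n-1}$. Define for $z\notin\mathbb{R}$ the $2\times2$ matrix $$Y(z)=\begin{pmatrix}P_n(z)&\frac{1}{2\pi i}\int_{\mathbb{R}}\frac{P_n(s)w(s)}{s-z}ds\\ -\frac{2\pi i}{h_{n-1}}P_{n-1}(z)&-\frac{1}{h_{n-1}}\int_{\mathbb{R}}\frac{P_{n-1}(s)w(s)}{s-z}ds\end{pmatrix},$$ and $\Phi(z;x):=\sigma_1{\rm e}^{\frac{x^2}{2}\sigma_3}Y(z+x){\rm e}^{-\frac12(z+x)^2\sigma_3}\sigma_1$, where $\sigma_1=\begin{pmatrix}0&1\\1&0\end{pmatrix}$, $\sigma_3=\begin{pmatrix}1&0\\0&-1\end{pmatrix}$. It is known that $\Phi$ satisfies $\partial_z\Phi=A(z;x)\Phi$ with $$A(z;x)=(z+x)\sigma_3+A_\infty(x)+\sum_{k=1}^m\frac{A_k(x)}{z-c_k},$$ $$A_\infty=\begin{pmatrix}0&y\\-2\big(\sum_{k}a_kb_k+n\big)/y&0\end{pmatrix},\qquad A_k=\begin{pmatrix}a_kb_k&a_ky\\-a_kb_k^2/y&-a_kb_k\end{pmatrix},$$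 for scalar functions $y(x)$, $a_k(x)$, $b_k(x)$; these define $a_k,b_k$ (namely $y=(A_\infty)_{12}$, $a_k=(A_k)_{12}/y$, $a_kb_k=(A_k)_{11}$). *)

(* Defs.v *)
From Stdlib Require Import Reals List.
From Coquelicot Require Import Coquelicot.
Open Scope R_scope.

Definition theta (y : R) : R := if Rlt_dec 0 y then 1 else 0.

Fixpoint sumR (m : nat) (f : nat -> R) : R :=
  match m with O => 0 | S m' => sumR m' f + f (S m') end.
Fixpoint sumC (m : nat) (f : nat -> C) : C :=
  match m with O => RtoC 0 | S m' => Cplus (sumC m' f) (f (S m')) end.

Definition rpoly := list R.
Fixpoint pevalR (p : rpoly) (s : R) : R :=
  match p with nil => 0 | cons a q => a + s * pevalR q s end.
Fixpoint pevalC (p : rpoly) (z : C) : C :=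
  match p with nil => RtoC 0 | cons a q => Cplus (RtoC a) (Cmult z (pevalC q z)) end.
Definition monic_deg (p : rpoly) (j : nat) : Prop :=
  length p = S j /\ List.nth j p 0 = 1.

Definition cexp (z : C) : C :=
  (exp (fst z) * cos (snd z), exp (fst z) * sin (snd z)).

Definition intR (f : R -> R) (l : R) : Prop :=
  is_RInt_gen f (Rbar_locally m_infty) (Rbar_locally p_infty) l.
Definition IntC (f : R -> C) : C :=
  RInt_gen (V := C_R_CompleteNormedModule) f
    (Rbar_locally m_infty) (Rbar_locally p_infty).

Definition omh (wh : nat -> R) (k : nat) : R := match k with O => 1 | _ => wh k end.
Definition om (wh : nat -> R) (k : nat) : R := omh wh k - omh wh (pred k).

Definition tt (c : nat -> R) (x : R) (k : nat) : R := c k + x.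

Definition weight (m : nat) (c wh : nat -> R) (x : R) (s : R) : R :=
  exp (- s ^ 2) * (1 + sumR m (fun k => om wh k * theta (s - tt c x k))).

Definition is_OP_family (w : R -> R) (P : nat -> rpoly) (h : nat -> R) : Prop :=
  (forall j, monic_deg (P j) j) /\ (forall k, 0 < h k) /\
  (forall j k, intR (fun s => pevalR (P j) s * pevalR (P k) s * w s)
                    (if Nat.eqb j k then h k else 0)).

Definition Rjk (m : nat) (c wh : nat -> R) (x : R) (P : nat -> rpoly) (h : nat -> R)
  (j k : nat) : R :=
  om wh k * exp (- (tt c x k) ^ 2) * (pevalR (P j) (tt c x k)) ^ 2 / h j.
Definition rnk (m : nat) (c wh : nat -> R) (x : R) (P : nat -> rpoly) (h : nat -> R)
  (n k : nat) : R :=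
  om wh k * exp (- (tt c x k) ^ 2) * pevalR (P n) (tt c x k)
    * pevalR (P (pred n)) (tt c x k) / h (pred n).

Record M2 := mkM2 { e11 : C; e12 : C; e21 : C; e22 : C }.
Definition mmul (A B : M2) : M2 :=
  mkM2 (Cplus (Cmult (e11 A) (e11 B)) (Cmult (e12 A) (e21 B)))
       (Cplus (Cmult (e11 A) (e12 B)) (Cmult (e12 A) (e22 B)))
       (Cplus (Cmult (e21 A) (e11 B)) (Cmult (e22 A) (e21 B)))
       (Cplus (Cmult (e21 A) (e12 B)) (Cmult (e22 A) (e22 B))).
Definition madd (A B : M2) : M2 :=
  mkM2 (Cplus (e11 A) (e11 B)) (Cplus (e12 A) (e12 B))
       (Cplus (e21 A) (e21 B)) (Cplus (e22 A) (e22 B)).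
Definition mscale (a : C) (A : M2) : M2 :=
  mkM2 (Cmult a (e11 A)) (Cmult a (e12 A)) (Cmult a (e21 A)) (Cmult a (e22 A)).
Definition sigma1 : M2 := mkM2 (RtoC 0) (RtoC 1) (RtoC 1) (RtoC 0).
Definition sigma3 : M2 := mkM2 (RtoC 1) (RtoC 0) (RtoC 0) (RtoC (-1)).
Definition exp_sigma3 (a : C) : M2 := mkM2 (cexp a) (RtoC 0) (RtoC 0) (cexp (Copp a)).
Fixpoint msum (m : nat) (F : nat -> M2) : M2 :=
  match m with O => mkM2 (RtoC 0) (RtoC 0) (RtoC 0) (RtoC 0)
             | S m' => madd (msum m' F) (F (S m')) end.

Definition cauchy (g w : R -> R) (z : C) : C :=
  IntC (fun s => Cdiv (RtoC (g s * w s)) (Cminus (RtoC s) z)).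

Definition two_pi_i : C := Cmult (RtoC (2 * PI)) Ci.

Definition Ymat (w : R -> R) (P : nat -> rpoly) (h : nat -> R) (n : nat) (z : C) : M2 :=
  mkM2 (pevalC (P n) z)
       (Cmult (Cinv two_pi_i) (cauchy (pevalR (P n)) w z))
       (Copp (Cmult (Cdiv two_pi_i (RtoC (h (pred n)))) (pevalC (P (pred n)) z)))
       (Copp (Cmult (Cinv (RtoC (h (pred n)))) (cauchy (pevalR (P (pred n))) w z))).

Definition Phi (w : R -> R) (P : nat -> rpoly) (h : nat -> R) (n : nat) (x : R) (z : C) : M2 :=
  let zx := Cplus z (RtoC x) in
  mmul sigma1 (mmul (exp_sigma3 (RtoC (x ^ 2 / 2)))
    (mmul (Ymat w P h n zx)
      (mmul (exp_sigma3 (Copp (Cdiv (Cmult zx zx) (RtoC 2)))) sigma1))).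

Definition Ainf (m n : nat) (y : C) (a b : nat -> C) : M2 :=
  mkM2 (RtoC 0) y
       (Cdiv (Cmult (RtoC (-2)) (Cplus (sumC m (fun k => Cmult (a k) (b k))) (RtoC (INR n)))) y)
       (RtoC 0).
Definition Ak (y : C) (a b : nat -> C) (k : nat) : M2 :=
  mkM2 (Cmult (a k) (b k)) (Cmult (a k) y)
       (Copp (Cdiv (Cmult (a k) (Cmult (b k) (b k))) y)) (Copp (Cmult (a k) (b k))).
Definition Alax (m n : nat) (c : nat -> R) (x : R) (y : C) (a b : nat -> C) (z : C) : M2 :=
  madd (mscale (Cplus z (RtoC x)) sigma3)
    (madd (Ainf m n y a b)
      (msum m (fun k => mscale (Cinv (Cminus z (RtoC (c k)))) (Ak y a b k)))).

Definition mderiv (F : C -> M2) (z : C) (D : M2) : Prop :=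
  is_derive (K := C_AbsRing) (V := C_NormedModule) (fun u => e11 (F u)) z (e11 D) /\
  is_derive (K := C_AbsRing) (V := C_NormedModule) (fun u => e12 (F u)) z (e12 D) /\
  is_derive (K := C_AbsRing) (V := C_NormedModule) (fun u => e21 (F u)) z (e21 D) /\
  is_derive (K := C_AbsRing) (V := C_NormedModule) (fun u => e22 (F u)) z (e22 D).

(* Main.v *)
Require Import Defs.
From Stdlib Require Import Reals Lra Lia List.
From Coquelicot Require Import Coquelicot.
Open Scope R_scope.

(** Write [u = z + x], [p = P_{n-1}], [q = P_n], [C0 u = \int w(s) / (s - u) ds] and
    [j_k = omega_k e^{-t_k^2}]. Since [w] is piecewise Gaussian, integration by parts gives
    [C0' + 2 u C0 = sum_k j_k / (t_k - u) - 2 h_0]. The Cauchy transform of [f w], for a polynomial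
    [f], is [f C0 + D_f] with [D_f] a polynomial, and orthogonality yields
    [p D_q - q D_p = h_{n-1}], that is [det Phi = 1]. Hence the entries of [A = Phi' Phi^{-1}] are
    [pq], [p^2], [q^2] times [sum_k j_k / (t_k - u)], up to constants and polynomials, and the
    residues at [c_k] give [a_k b_k], [a_k y] and [a_k b_k^2 / y]. The value of [y] comes from the
    leading coefficients in the equation for [Phi_12], and [sum_k r_{n,k} + n = 2 h_n / h_{n-1}]
    from integrating [(P_n P_{n-1} e^{-s^2})'] piecewise. *)

(** * Complex derivatives *)

(** The obstacle: the Lax equation is given only off the real line, while the poles lie on it, where
    the Cauchy transforms are singular. No boundary values of [Phi] are taken. Instead [C0] cancels
    in [Phi' Phi^{-1}]: once the differential equation has replaced [C0'], the first column and its
    derivative contain [C0] as one common multiple of the second column and its derivative, and such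
    a multiple drops out of the 2 by 2 determinants that give [A]. What survives extends across the
    line after multiplication by [z - c_k], and functions differentiable at a real point that agree
    off the line agree there. Infinity is treated in the same way: [Phi_12] is a polynomial times an
    exponential, so no asymptotic expansion of a Cauchy transform enters. The last residue gives
    [a_k b_k^2 = R_{n,k} * 2 h_n / h_{n-1}]; the factor is then recognized as the denominator
    [sum_j a_j b_j + n], which also shows that it does not vanish. *)

Definition Cder (f : C -> C) (z l : C) : Prop :=
  is_derive (K := C_AbsRing) (V := C_NormedModule) f z l.

(** The derivative asks for the estimate at every limit point of the filter; the limit point of
    [locally z] is unique, which leaves one bound in [Cmod]. The derivatives of the exponential, of
    1 / (z - u) and of the resolvent are proved in this form. *)
Lemma Cder_eps (f : C -> C) (z l : C) :
  (forall eps, 0 < eps -> exists d, 0 < d /\ forall w : C, Cmod (w - z) < d ->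
     Cmod (f w - f z - (w - z) * l) <= eps * Cmod (w - z)) ->
  Cder f z l.
Proof.
  intros H. split.
  - apply (is_linear_scal_l (K := C_AbsRing) (V := C_NormedModule)).
  - intros y Hy. apply (is_filter_lim_locally_unique (K:=C_AbsRing) (V:=AbsRing_NormedModule
      C_AbsRing)) in Hy.
    subst y. intros eps. destruct (H eps (cond_pos eps)) as [d [Hd Hf]].
    exists (mkposreal d Hd). intros w Hw. apply (Hf w). exact Hw.
Qed.

Lemma Cder_lim (f : C -> C) (z l : C) : Cder f z l ->
  forall eps, 0 < eps -> exists d, 0 < d /\ forall w : C, Cmod (w - z) < d ->
     Cmod (f w - f z - (w - z) * l) <= eps * Cmod (w - z).
Proof.
  intros [_ H] eps He.
  destruct (H z (fun P HP => HP) (mkposreal eps He)) as [d Hd].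
  exists d. split. apply cond_pos. intros w Hw. apply (Hd w Hw).
Qed.

Lemma Cder_unique (f : C -> C) (z l1 l2 : C) : Cder f z l1 -> Cder f z l2 -> l1 = l2.
Proof.
  intros H1 H2. rewrite <- (is_C_derive_unique _ _ _ H1). apply is_C_derive_unique, H2.
Qed.

Lemma Cder_ext (f g : C -> C) (z l : C) : (forall w, f w = g w) -> Cder f z l -> Cder g z l.
Proof. intros E. apply (is_derive_ext (K := C_AbsRing) (V := C_NormedModule)). exact E. Qed.

Lemma Cder_const (a z : C) : Cder (fun _ => a) z (RtoC 0).
Proof. apply (is_derive_const (K := C_AbsRing) (V := C_NormedModule)). Qed.

Lemma Cder_id (z : C) : Cder (fun w => w) z (RtoC 1).
Proof.
  apply Cder_eps. intros eps He. exists 1. split; [lra|]. intros w _.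
  replace (w - z - (w - z) * 1)%C with (RtoC 0) by ring. rewrite Cmod_0.
  pose proof (Cmod_ge_0 (w - z)). nra.
Qed.

Lemma Cder_plus (f g : C -> C) (z df dg : C) :
  Cder f z df -> Cder g z dg -> Cder (fun w => Cplus (f w) (g w)) z (Cplus df dg).
Proof. apply (is_derive_plus (K := C_AbsRing) (V := C_NormedModule)). Qed.

(** The product and chain rules are stated for the field as a module over itself, while [mderiv]
    uses [C_NormedModule]; the estimates of the two are convertible. *)
Lemma Cder_absring (f : C -> C) (z l : C) :
  Cder f z l <-> is_derive (K := C_AbsRing) (V := AbsRing_NormedModule C_AbsRing) f z l.
Proof.
  split; intros H.
  - split; [apply (is_linear_scal_l (K := C_AbsRing) (V := AbsRing_NormedModule C_AbsRing))|].
    exact (proj2 H).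
  - split; [apply (is_linear_scal_l (K := C_AbsRing) (V := C_NormedModule))|].
    exact (proj2 H).
Qed.

Lemma Cder_mult (f g : C -> C) (z df dg : C) :
  Cder f z df -> Cder g z dg ->
  Cder (fun w => Cmult (f w) (g w)) z (Cplus (Cmult df (g z)) (Cmult (f z) dg)).
Proof.
  rewrite !Cder_absring. intros Hf Hg.
  exact (@is_derive_mult C_AbsRing f g z df dg Hf Hg Cmult_comm).
Qed.

Lemma Cder_comp (f g : C -> C) (z df dg : C) :
  Cder f (g z) df -> Cder g z dg -> Cder (fun w => f (g w)) z (Cmult dg df).
Proof.
  rewrite (Cder_absring g). intros Hf Hg.
  exact (@is_derive_comp C_AbsRing C_NormedModule f g z df dg Hf Hg).
Qed.

Lemma Cder_val (f : C -> C) (z l l' : C) : Cder f z l -> l = l' -> Cder f z l'.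
Proof. intros H ->. exact H. Qed.

Lemma cexp_plus (a b : C) : cexp (a + b) = (cexp a * cexp b)%C.
Proof.
  destruct a as [a1 a2], b as [b1 b2]. unfold cexp, Cmult, Cplus; simpl.
  rewrite exp_plus, cos_plus, sin_plus. f_equal; ring.
Qed.

Lemma cexp_0 : cexp 0 = 1.
Proof. unfold cexp; simpl. rewrite exp_0, cos_0, sin_0. unfold RtoC. f_equal; ring. Qed.

Lemma cexp_opp_r (a : C) : (cexp a * cexp (- a) = 1)%C.
Proof. rewrite <- cexp_plus, Cplus_opp_r. apply cexp_0. Qed.

Lemma cexp_R (r : R) : cexp (RtoC r) = RtoC (exp r).
Proof. unfold cexp, RtoC; simpl. rewrite cos_0, sin_0. f_equal; ring. Qed.

Lemma derive_approx (f : R -> R) (l : R) : is_derive f 0 l ->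
  forall eps, 0 < eps -> exists d, 0 < d /\ forall t, Rabs t < d ->
    Rabs (f t - f 0 - t * l) <= eps * Rabs t.
Proof.
  intros [_ H] eps He.
  destruct (H 0 (fun P HP => HP) (mkposreal eps He)) as [d Hd].
  exists d. split. apply cond_pos. intros t Ht.
  specialize (Hd t).
  assert (Hb : ball (M := R_UniformSpace) 0 d t).
  { unfold ball; simpl; unfold AbsRing_ball, abs, minus, plus, opp; simpl.
    replace (t + - 0) with t by ring. exact Ht. }
  specialize (Hd Hb). cbn in Hd. unfold norm, minus, plus, opp, scal in Hd; simpl in Hd.
  unfold abs, mult in Hd; simpl in Hd.
  replace (t + - 0) with t in Hd by ring. unfold Rminus. exact Hd.
Qed.

(** Real and imaginary parts are estimated separately, through the real derivatives of exp, cos and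
    sin at 0; the functional equation carries the result to every point in [Cder_cexp]. *)
Lemma cexp_der_0 : Cder cexp 0 1.
Proof.
  apply Cder_eps. intros eps He.
  (* Each component of the remainder will be at most 4 e N, with N the modulus of the increment, and
     passing from components to modulus costs at most sqrt 2 <= 2; hence eps / 8. The bound by 1
     gives |1 + a| <= 2. *)
  assert (He4 : 0 < Rmin (eps / 8) 1) by (apply Rmin_pos; lra).
  set (e := Rmin (eps/8) 1) in *.
  assert (e <= eps / 8) by apply Rmin_l. assert (e <= 1) by apply Rmin_r.
  destruct (derive_approx exp 1) with (eps := e) as [d1 [Hd1 H1]]; auto.
  { rewrite <- exp_0. apply is_derive_exp. }
  destruct (derive_approx cos 0) with (eps := e) as [d2 [Hd2 H2]]; auto.
  { auto_derive; auto. rewrite sin_0; ring. }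
  destruct (derive_approx sin 1) with (eps := e) as [d3 [Hd3 H3]]; auto.
  { rewrite <- cos_0. apply is_derive_sin. }
  exists (Rmin e (Rmin d1 (Rmin d2 d3))). split.
  { apply Rmin_pos; [exact He4|]. repeat apply Rmin_pos; auto. }
  intros [a b] Hw.
  replace ((a, b) - 0)%C with ((a,b):C) in * by (unfold Cminus, Cplus, Copp, RtoC; simpl; f_equal;
      ring).
  assert (Ha : Rabs a <= Cmod (a,b)).
  { eapply Rle_trans; [ | apply Rmax_Cmod]. apply Rmax_l. }
  assert (Hb : Rabs b <= Cmod (a,b)).
  { eapply Rle_trans; [ | apply Rmax_Cmod]. apply Rmax_r. }
  assert (Hwe : Cmod (a,b) < e) by (eapply Rlt_le_trans; [exact Hw| apply Rmin_l]).
  assert (Hw' : Cmod (a,b) < Rmin d1 (Rmin d2 d3)) by (eapply Rlt_le_trans; [exact Hw| apply Rmin_r]).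
  assert (Hw1 : Cmod (a,b) < d1) by (eapply Rlt_le_trans; [exact Hw'| apply Rmin_l]).
  assert (Hw'' : Cmod (a,b) < (Rmin d2 d3)) by (eapply Rlt_le_trans; [exact Hw'| apply Rmin_r]).
  assert (Hw2 : Cmod (a,b) < d2) by (eapply Rlt_le_trans; [exact Hw''| apply Rmin_l]).
  assert (Hw3 : Cmod (a,b) < d3) by (eapply Rlt_le_trans; [exact Hw''| apply Rmin_r]).
  clear Hw Hw' Hw''.
  specialize (H1 a ltac:(lra)). specialize (H2 b ltac:(lra)). specialize (H3 b ltac:(lra)).
  rewrite exp_0 in H1. rewrite cos_0 in H2. rewrite sin_0 in H3.
  set (N := Cmod (a, b)) in *.
  assert (HN : 0 <= N) by apply Cmod_ge_0.
  rewrite cexp_0.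
  assert (Hr : Rabs (exp a * cos b - 1 - a) <= 4 * e * N).
  { replace (exp a * cos b - 1 - a) with
      ((exp a - 1 - a * 1) * cos b + (1 + a) * (cos b - 1 - b * 0)) by ring.
    eapply Rle_trans; [apply Rabs_triang|]. rewrite !Rabs_mult.
    assert (Rabs (cos b) <= 1) by (apply Rabs_le, COS_bound).
    assert (Rabs (1 + a) <= 2) by (eapply Rle_trans; [apply Rabs_triang|]; rewrite Rabs_R1; lra).
    assert (Rabs (exp a - 1 - a * 1) * Rabs (cos b) <= e * N * 1).
    { apply Rmult_le_compat; auto; try apply Rabs_pos. nra. }
    assert (Rabs (1 + a) * Rabs (cos b - 1 - b * 0) <= 2 * (e * N)).
    { apply Rmult_le_compat; auto; try apply Rabs_pos. nra. }
    nra. }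
  assert (Hi : Rabs (exp a * sin b - b) <= 4 * e * N).
  { replace (exp a * sin b - b) with
      ((exp a - 1 - a * 1) * sin b + (1 + a) * (sin b - 0 - b * 1) + a * b) by ring.
    eapply Rle_trans; [apply Rabs_triang|].
    eapply Rle_trans; [apply Rplus_le_compat_r, Rabs_triang|]. rewrite !Rabs_mult.
    assert (Rabs (sin b) <= 1) by (apply Rabs_le, SIN_bound).
    assert (Rabs (1 + a) <= 2) by (eapply Rle_trans; [apply Rabs_triang|]; rewrite Rabs_R1; lra).
    assert (Rabs (exp a - 1 - a * 1) * Rabs (sin b) <= e * N * 1).
    { apply Rmult_le_compat; auto; try apply Rabs_pos. nra. }
    assert (Rabs (1 + a) * Rabs (sin b - 0 - b * 1) <= 2 * (e * N)).
    { apply Rmult_le_compat; auto; try apply Rabs_pos. nra. }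
    assert (Rabs a * Rabs b <= e * N).
    { apply Rmult_le_compat; auto; try apply Rabs_pos. lra. }
    nra. }
  eapply Rle_trans; [apply Cmod_2Rmax|].
  replace (cexp (a,b) - 1 - (a,b) * 1)%C with ((exp a * cos b - 1 - a, exp a * sin b - b) : C)
   by (unfold cexp, Cminus, Cplus, Cmult, Copp, RtoC; simpl; f_equal; ring).
  cbn [fst snd].
  assert (Hs : sqrt 2 <= 2).
  { rewrite <- (sqrt_square 2) at 2 by lra. apply sqrt_le_1; lra. }
  assert (0 <= sqrt 2) by apply sqrt_pos.
  assert (Rmax (Rabs (exp a * cos b - 1 - a)) (Rabs (exp a * sin b - b)) <= 4 * e * N).
  { apply Rmax_lub; auto. }
  assert (0 <= Rmax (Rabs (exp a * cos b - 1 - a)) (Rabs (exp a * sin b - b))).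
  { eapply Rle_trans; [apply Rabs_pos| apply Rmax_l]. }
  nra.
Qed.

Lemma Cder_cexp (z : C) : Cder cexp z (cexp z).
Proof.
  apply Cder_ext with (f := fun w => (cexp z * cexp (w - z))%C).
  { intros w. rewrite <- cexp_plus. f_equal. ring. }
  eapply Cder_val.
  - apply Cder_mult. apply Cder_const.
    apply (Cder_comp cexp (fun w => (w - z)%C)).
    + replace (z - z)%C with (RtoC 0) by ring. apply cexp_der_0.
    + apply Cder_plus. apply Cder_id. apply Cder_const.
  - simpl. ring.
Qed.

(** * Complex-valued improper integrals *)

(** Relational form of [IntC]: it carries convergence, which the total function does not. *)
Definition is_IntC (f : R -> C) (l : C) : Prop :=
  is_RInt_gen (V := C_R_NormedModule) f (Rbar_locally m_infty) (Rbar_locally p_infty) l.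

Lemma is_IntC_unique (f : R -> C) (l : C) : is_IntC f l -> IntC f = l.
Proof. intros H. exact (is_RInt_gen_unique (V := C_R_CompleteNormedModule) f l H). Qed.

Lemma is_IntC_eq (f : R -> C) (l l' : C) : is_IntC f l -> is_IntC f l' -> l = l'.
Proof. intros H H'. rewrite <- (is_IntC_unique f l H). apply is_IntC_unique, H'. Qed.

Lemma is_IntC_ext (f g : R -> C) (l : C) : (forall s, f s = g s) -> is_IntC f l -> is_IntC g l.
Proof.
  intros E H. unfold is_IntC. apply (is_RInt_gen_ext (V := C_R_NormedModule) f); auto.
  apply filter_forall. intros; apply E.
Qed.

Lemma is_IntC_val (f : R -> C) (l l' : C) : is_IntC f l -> l = l' -> is_IntC f l'.
Proof. intros H ->. exact H. Qed.

Lemma is_IntC_plus (f g : R -> C) (lf lg : C) : is_IntC f lf -> is_IntC g lg ->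
  is_IntC (fun s => f s + g s)%C (lf + lg)%C.
Proof. intros Hf Hg. exact (is_RInt_gen_plus (V := C_R_NormedModule) f g lf lg Hf Hg). Qed.

Lemma is_IntC_pair (f : R -> C) (l : C) :
  intR (fun s => fst (f s)) (fst l) -> intR (fun s => snd (f s)) (snd l) -> is_IntC f l.
Proof.
  intros H1 H2. unfold is_IntC, is_RInt_gen.
  apply (proj2 (filterlimi_locally (U := C_R_NormedModule) _ l)). intros eps.
  pose proof (proj1 (filterlimi_locally _ _) H1 eps) as K1.
  pose proof (proj1 (filterlimi_locally _ _) H2 eps) as K2.
  generalize (filter_and _ _ K1 K2). apply filter_imp.
  intros ab [[z1 [I1 B1]] [z2 [I2 B2]]].
  exists (z1, z2). split.
  - apply (is_RInt_fct_extend_pair (U := R_NormedModule) (V := R_NormedModule)); assumption.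
  - split; assumption.
Qed.

Lemma is_IntC_fst (f : R -> C) (l : C) : is_IntC f l -> intR (fun s => fst (f s)) (fst l).
Proof.
  intros H. apply filterlimi_locally. intros eps.
  pose proof (proj1 (filterlimi_locally (U := C_R_NormedModule) _ _) H eps) as K.
  revert K. apply filter_imp. intros ab [z [I [B1 B2]]].
  exists (fst z). split; auto.
  apply (is_RInt_fct_extend_fst (U := R_NormedModule) (V := R_NormedModule)), I.
Qed.

Lemma is_IntC_snd (f : R -> C) (l : C) : is_IntC f l -> intR (fun s => snd (f s)) (snd l).
Proof.
  intros H. apply filterlimi_locally. intros eps.
  pose proof (proj1 (filterlimi_locally (U := C_R_NormedModule) _ _) H eps) as K.
  revert K. apply filter_imp. intros ab [z [I [B1 B2]]].
  exists (snd z). split; auto.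
  apply (is_RInt_fct_extend_snd (U := R_NormedModule) (V := R_NormedModule)), I.
Qed.

Lemma intR_ext (f g : R -> R) (l : R) : (forall s, f s = g s) -> intR f l -> intR g l.
Proof.
  intros E H. apply (is_RInt_gen_ext f); auto. apply filter_forall. intros; apply E.
Qed.

Lemma intR_lin (f g : R -> R) (a b lf lg : R) : intR f lf -> intR g lg ->
  intR (fun s => a * f s + b * g s) (a * lf + b * lg).
Proof.
  intros Hf Hg.
  exact (is_RInt_gen_plus (V := R_NormedModule) _ _ _ _
    (is_RInt_gen_scal (V := R_NormedModule) f a lf Hf)
    (is_RInt_gen_scal (V := R_NormedModule) g b lg Hg)).
Qed.

Lemma intR_zero : intR (fun _ => 0) 0.
Proof.
  apply (filterlimi_lim_ext (fun _ => 0)).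
  - intros ab. pose proof (is_RInt_const (V := R_NormedModule) (fst ab) (snd ab) 0) as K.
    unfold scal in K; simpl in K; unfold mult in K; simpl in K. rewrite Rmult_0_r in K. exact K.
  - apply filterlim_const.
Qed.

Lemma is_IntC_RtoC (f : R -> R) (l : R) : intR f l -> is_IntC (fun s => RtoC (f s)) (RtoC l).
Proof. intros H. apply is_IntC_pair; simpl; auto. apply intR_zero. Qed.

(** The module structure here is over the reals, so a complex factor is pulled out through the two
    component integrals. *)
Lemma is_IntC_mult (a : C) (f : R -> C) (l : C) : is_IntC f l ->
  is_IntC (fun s => a * f s)%C (a * l)%C.
Proof.
  intros H. pose proof (is_IntC_fst _ _ H) as H1. pose proof (is_IntC_snd _ _ H) as H2.
  apply is_IntC_pair; simpl.
  - eapply intR_ext; [|exact (eq_rect _ _ (intR_lin _ _ (fst a) (- snd a) _ _ H1 H2) _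
      ltac:(instantiate (1 := fst a * fst l - snd a * snd l); ring))].
    intros s; simpl; ring.
  - exact (intR_lin _ _ (fst a) (snd a) _ _ H2 H1).
Qed.

Lemma is_IntC_norm (f : R -> C) (g : R -> R) (l : C) (lg : R) :
  (forall s, Cmod (f s) <= g s) -> is_IntC f l -> intR g lg -> Cmod l <= lg.
Proof.
  intros Hb Hf Hg. rewrite Cmod_norm.
  eapply (RInt_gen_norm (V := C_R_CompleteNormedModule)
     (Fa := Rbar_locally m_infty) (Fb := Rbar_locally p_infty) f g); eauto.
  - exists (fun a => a < 0) (fun b => 0 < b). exists 0; auto. exists 0; auto. simpl; intros; lra.
  - apply filter_forall. intros ab s _. rewrite <- Cmod_norm. apply Hb.
Qed.

(** Cauchy criterion: the integrals over two large intervals differ by two end pieces, each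
    dominated by the same piece of the integral of [g], which converges. *)
Lemma is_IntC_dominated (f : R -> C) (g : R -> R) (lg : R) :
  (forall a b, ex_RInt (V := C_R_CompleteNormedModule) f a b) ->
  (forall a b, ex_RInt g a b) ->
  (forall s, Cmod (f s) <= g s) -> intR g lg -> exists l, is_IntC f l.
Proof.
  intros Hf Hg Hb Hi.
  (* The absolute value on the right allows a > b: two lower ends, or two upper ends, come in no
     particular order. *)
  assert (Hdom : forall a b, norm (RInt (V := C_R_CompleteNormedModule) f a b) <= Rabs (RInt g a b)).
  { intros a b.
    assert (Hle : forall a b, a <= b -> norm (RInt (V := C_R_CompleteNormedModule) f a b) <= Rabs
        (RInt g a b)).
    { intros a' b' Hab. eapply Rle_trans; [|apply Rle_abs].
      apply (norm_RInt_le (V := C_R_NormedModule) f g a' b'); auto.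
      - intros; rewrite <- Cmod_norm; apply Hb.
      - apply (RInt_correct (V := C_R_CompleteNormedModule)), Hf.
      - apply (RInt_correct (V := R_CompleteNormedModule)), Hg. }
    destruct (Rle_dec a b) as [Hab|Hab]; [auto|].
    rewrite <- (opp_RInt_swap (V := C_R_CompleteNormedModule) f) by apply Hf.
    rewrite <- (opp_RInt_swap (V := R_CompleteNormedModule) g) by apply Hg.
    rewrite (norm_opp (V := C_R_NormedModule)).
    replace (Rabs (opp (RInt g b a))) with (Rabs (RInt g b a)) by (symmetry; apply Rabs_Ropp).
    apply Hle; lra. }
  refine (proj1 (filterlimi_locally_cauchy (U := C_R_CompleteNormedModule)
     (F := filter_prod (Rbar_locally m_infty) (Rbar_locally p_infty))
     (fun ab => is_RInt (V := C_R_NormedModule) f (fst ab) (snd ab)) _) _).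
  { apply filter_forall. intros [a b]; simpl. split.
    - apply (Hf a b).
    - intros y1 y2 E1 E2. rewrite <- (is_RInt_unique (V := C_R_CompleteNormedModule) _ _ _ _ E1).
      apply (is_RInt_unique (V := C_R_CompleteNormedModule)), E2. }
  intros eps.
  (* Each end piece of the integral of [g] is a difference of two values within eps / 8 of [lg],
     hence below eps / 2, and there are two pieces. *)
  pose proof (proj1 (filterlimi_locally _ _) Hi (pos_div_2 (pos_div_2 (pos_div_2 eps)))) as K.
  destruct K as [Q S HQ HS HK].
  exists (fun ab => Q (fst ab) /\ S (snd ab)). split.
  { exists Q S; auto. }
  assert (HG : forall a b, Q a -> S b -> Rabs (RInt g a b - lg) < eps / 2 / 2 / 2).
  { intros a b Ha Hb'. destruct (HK a b Ha Hb') as [z [Hz Bz]]. simpl in Hz.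
    rewrite (is_RInt_unique (V := R_CompleteNormedModule) _ _ _ _ Hz).
    apply Rabs_def2 in Bz. unfold minus, plus, opp in Bz; simpl in Bz.
    apply Rabs_def1; lra. }
  intros [a b] [a' b'] [Ha Hb1] [Ha' Hb'] u v Hu Hv. simpl in *.
  apply (is_RInt_unique (V := C_R_CompleteNormedModule)) in Hu, Hv. subst u v.
  apply (norm_compat1 (V := C_R_NormedModule)).
  assert (E : minus (RInt (V := C_R_CompleteNormedModule) f a' b') (RInt (V :=
      C_R_CompleteNormedModule) f a b)
     = plus (RInt (V := C_R_CompleteNormedModule) f a' a) (RInt (V := C_R_CompleteNormedModule) f b
         b')).
  { rewrite <- (RInt_Chasles (V := C_R_CompleteNormedModule) f a' a b') by apply Hf.
    rewrite <- (RInt_Chasles (V := C_R_CompleteNormedModule) f a b b') by apply Hf.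
    generalize (RInt (V := C_R_CompleteNormedModule) f a' a) (RInt (V := C_R_CompleteNormedModule)
        f a b)
      (RInt (V := C_R_CompleteNormedModule) f b b'). intros x1 x2 x3.
    change ((x1 + (x2 + x3)) - x2 = x1 + x3)%C. ring. }
  eapply Rle_lt_trans; [apply Req_le; exact (f_equal (@norm R_AbsRing C_R_NormedModule) E)|].
  eapply Rle_lt_trans; [apply (norm_triangle (V := C_R_NormedModule))|].
  assert (N1 := Hdom a' a). assert (N2 := Hdom b b').
  assert (E1 : RInt g a' a = RInt g a' b - RInt g a b).
  { pose proof (RInt_Chasles (V := R_CompleteNormedModule) g a' a b (Hg _ _) (Hg _ _)) as K.
    change (RInt g a' a + RInt g a b = RInt g a' b) in K. lra. }
  assert (E2 : RInt g b b' = RInt g a b' - RInt g a b).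
  { pose proof (RInt_Chasles (V := R_CompleteNormedModule) g a b b' (Hg _ _) (Hg _ _)) as K.
    change (RInt g a b + RInt g b b' = RInt g a b') in K. lra. }
  pose proof (Rabs_def2 _ _ (HG a b Ha Hb1)). pose proof (Rabs_def2 _ _ (HG a' b Ha' Hb1)).
  pose proof (Rabs_def2 _ _ (HG a b' Ha Hb')).
  assert (Rabs (RInt g a' a) < eps / 2) by (rewrite E1; apply Rabs_def1; lra).
  assert (Rabs (RInt g b b') < eps / 2) by (rewrite E2; apply Rabs_def1; lra).
  change (@norm R_AbsRing C_R_NormedModule (RInt (V := C_R_CompleteNormedModule) f a' a)
    + @norm R_AbsRing C_R_NormedModule (RInt (V := C_R_CompleteNormedModule) f b b') < eps).
  eapply Rle_lt_trans. apply Rplus_le_compat; [exact N1 | exact N2]. lra.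
Qed.

(** * Integrals against step functions *)

Lemma theta_1 (y : R) : 0 < y -> theta y = 1.
Proof. intros H. unfold theta. destruct (Rlt_dec 0 y); [reflexivity|lra]. Qed.

Lemma theta_0 (y : R) : y <= 0 -> theta y = 0.
Proof. intros H. unfold theta. destruct (Rlt_dec 0 y); [lra|reflexivity]. Qed.

(** [F (Rmax s t)] acts as the antiderivative of the integrand: constant up to [t], then [F]. This
    form covers every order of [a], [b] and [t]. *)
Lemma is_RInt_theta {V : CompleteNormedModule R_AbsRing} (f F : R -> V) (t a b : R) :
  (forall s, is_derive F s (f s)) -> (forall s, continuous f s) ->
  is_RInt (fun s => scal (theta (s - t)) (f s)) a b (minus (F (Rmax b t)) (F (Rmax a t))).
Proof.
  intros HF Hc.
  assert (K : forall b, is_RInt (fun s => scal (theta (s - t)) (f s)) t b (minus (F (Rmax b t)) (F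
      t))).
  { clear a b. intros b. destruct (Rle_dec t b) as [Hb|Hb].
    - rewrite Rmax_left by lra. apply is_RInt_ext with (f := f).
      + intros s. rewrite Rmin_left, Rmax_right by lra. intros Hs.
        rewrite theta_1 by lra. exact (eq_sym (scal_one (f s))).
      + apply (is_RInt_derive F f); auto.
    - rewrite Rmax_right by lra. replace (minus (F t) (F t)) with (zero : V) by (symmetry; apply
        (minus_eq_zero (F t))).
      apply is_RInt_ext with (f := fun _ => zero).
      + intros s. rewrite Rmin_right, Rmax_left by lra. intros Hs.
        rewrite theta_0 by lra. exact (eq_sym (scal_zero_l (f s))).
      + exact (eq_ind _ (is_RInt (fun _ : R => (zero : V)) t b) (is_RInt_const (V := V) t b zero) _
          (scal_zero_r (K := R_AbsRing) (V := V) (b - t))). }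
  assert (E : minus (F (Rmax b t)) (F (Rmax a t)) =
    plus (opp (minus (F (Rmax a t)) (F t))) (minus (F (Rmax b t)) (F t))).
  { rewrite opp_minus, plus_comm. apply minus_trans. }
  rewrite E. exact (is_RInt_Chasles (V := V) _ a t b _ _ (is_RInt_swap (V := V) _ _ _ _ (K a)) (K b)).
Qed.

Lemma ex_RInt_theta {V : CompleteNormedModule R_AbsRing} (f : R -> V) (t a b : R) :
  (forall s, continuous f s) -> ex_RInt (fun s => scal (theta (s - t)) (f s)) a b.
Proof.
  intros Hc. eexists. apply (is_RInt_theta f (RInt f 0)); auto.
  intros s. apply (is_derive_RInt f (RInt f 0) 0 s); auto.
  apply filter_forall. intros y. apply (RInt_correct f).
  apply (ex_RInt_continuous (V := V)). auto.
Qed.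

(** The piecewise constant factor of [weight], split from the Gaussian, which is the restriction of
    an entire function and can be differentiated by complex rules. *)
Definition wsum (m : nat) (c wh : nat -> R) (x s : R) : R :=
  1 + sumR m (fun k => om wh k * theta (s - tt c x k)).

Lemma ex_RInt_wsum {V : CompleteNormedModule R_AbsRing} (f : R -> V) m c wh x (a b : R) :
  (forall s, continuous f s) -> ex_RInt (fun s => scal (wsum m c wh x s) (f s)) a b.
Proof.
  intros Hc. unfold wsum. induction m as [|m IH]; simpl.
  - apply ex_RInt_ext with (f := f).
    + intros s _. rewrite Rplus_0_r. exact (eq_sym (scal_one (f s))).
    + apply (ex_RInt_continuous (V := V)). auto.
  - apply ex_RInt_ext with (f := fun s => plus
      (scal (1 + sumR m (fun k => om wh k * theta (s - tt c x k))) (f s))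
      (scal (om wh (S m)) (scal (theta (s - tt c x (S m))) (f s)))).
    + intros s _. rewrite scal_assoc, <- scal_distr_r. f_equal.
      unfold plus, mult; simpl. ring.
    + apply (ex_RInt_plus (V := V)); [exact IH|].
      apply (ex_RInt_scal (V := V)). apply ex_RInt_theta, Hc.
Qed.

Lemma is_derive_R_of_Cder (F : C -> C) (s : R) (l : C) : Cder F (RtoC s) l ->
  is_derive (K := R_AbsRing) (V := C_R_NormedModule) (fun t : R => F (RtoC t)) s l.
Proof.
  intros H. split.
  - apply (is_linear_scal_l (K := R_AbsRing) (V := C_R_NormedModule)).
  - intros y Hy. apply (is_filter_lim_locally_unique (K:=R_AbsRing) (V:=R_NormedModule)) in Hy.
    subst y. intros eps. destruct (Cder_lim F (RtoC s) l H eps (cond_pos eps)) as [d [Hd Hf]].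
    exists (mkposreal d Hd). intros t Ht.
    assert (E : Cmod (RtoC t - RtoC s) = Rabs (t - s)).
    { rewrite <- RtoC_minus. apply Cmod_R. }
    specialize (Hf (RtoC t)). rewrite E in Hf. specialize (Hf Ht).
    rewrite <- Cmod_norm.
    eapply Rle_trans; [|exact Hf]. apply Req_le. f_equal.
    destruct (F (RtoC t)), (F (RtoC s)), l.
    cbv. f_equal; ring.
Qed.

Lemma continuous_R_of_Cder (F : C -> C) (s : R) (l : C) : Cder F (RtoC s) l ->
  continuous (U := C_R_NormedModule) (fun t : R => F (RtoC t)) s.
Proof.
  intros H. apply (ex_derive_continuous (K := R_AbsRing) (V := C_R_NormedModule)).
  exists l. apply is_derive_R_of_Cder, H.
Qed.

(** * Integration by parts against a piecewise Gaussian weight *)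

Lemma decay_lim (F : R -> C) (M : R) : (forall s, Cmod (F s) * (1 + s ^ 2) <= M) ->
  filterlim F (Rbar_locally m_infty) (locally (T := C_R_NormedModule) (RtoC 0)) /\
  filterlim F (Rbar_locally p_infty) (locally (T := C_R_NormedModule) (RtoC 0)).
Proof.
  intros H.
  assert (K : forall (eps : posreal) s, M / eps + 1 < Rabs s -> ball (M := C_R_NormedModule) (RtoC
      0) eps (F s)).
  { intros eps s Hs. apply (norm_compat1 (V := C_R_NormedModule)).
    assert (HM : 0 <= M).
    { eapply Rle_trans; [|apply (H s)]. apply Rmult_le_pos; [apply Cmod_ge_0|nra]. }
    assert (He := cond_pos eps).
    assert (Hme : 0 <= M / eps) by (apply Rdiv_le_0_compat; lra).
    assert (Hs2 : M / eps < 1 + s ^ 2). { rewrite <- pow2_abs. nra. }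
    apply Rle_lt_trans with (Cmod (F s)).
    { apply Req_le. rewrite Cmod_norm. f_equal.
      change (F s - 0 = F s)%C. ring. }
    apply Rnot_le_lt. intros Hc. specialize (H s).
    assert (M = M / eps * eps) by (field; lra).
    assert (eps * (1 + s ^ 2) <= Cmod (F s) * (1 + s ^ 2)) by (apply Rmult_le_compat_r; nra).
    nra. }
  split; apply filterlim_locally; intros eps.
  - exists (- (Rabs (M / eps + 1))). intros s Hs. apply K.
    pose proof (Rle_abs (M / eps + 1)). pose proof (Rabs_pos (M / eps + 1)).
    rewrite Rabs_left; lra.
  - exists (Rabs (M / eps + 1)). intros s Hs. apply K.
    pose proof (Rle_abs (M / eps + 1)). pose proof (Rabs_pos (M / eps + 1)).
    rewrite Rabs_pos_eq; lra.
Qed.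

Lemma filterlim_minus {V : NormedModule R_AbsRing} (a b : V) :
  filterlim (fun z : V * V => minus (fst z) (snd z)) (filter_prod (locally a) (locally b))
    (locally (minus a b)).
Proof.
  eapply (filterlim_comp_2 (G := locally a) (H := locally (opp b)) fst (fun z => opp (snd z)) plus).
  - apply filterlim_fst.
  - eapply filterlim_comp; [apply filterlim_snd|apply filterlim_opp].
  - apply filterlim_plus.
Qed.

Section byparts.
Variables (F f : R -> C) (M : R).
Hypothesis HF : forall s, is_derive (V := C_R_NormedModule) F s (f s).
Hypothesis Hf : forall s, continuous (U := C_R_NormedModule) f s.
Hypothesis HM : forall s, Cmod (F s) * (1 + s ^ 2) <= M.

Lemma is_IntC_derive_decay : is_IntC f 0.
Proof.
  destruct (decay_lim F M HM) as [Lm Lp].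
  replace (RtoC 0) with (minus (G := C_R_NormedModule) (RtoC 0) (RtoC 0)) by apply (minus_eq_zero
      (G := C_R_NormedModule)).
  unfold is_IntC, is_RInt_gen.
  apply (filterlimi_lim_ext (fun ab => minus (G := C_R_NormedModule) (F (snd ab)) (F (fst ab)))).
  - intros [a b]; simpl. apply (is_RInt_derive (V := C_R_CompleteNormedModule) F f); auto.
  - eapply (filterlim_comp_2 (G := locally (T := C_R_NormedModule) (RtoC 0))
      (H := locally (T := C_R_NormedModule) (RtoC 0)) (fun ab => F (snd ab)) (fun ab => F (fst ab))
      (minus (G := C_R_NormedModule))).
    + eapply filterlim_comp; [apply filterlim_snd|exact Lp].
    + eapply filterlim_comp; [apply filterlim_fst|exact Lm].
    + apply (filterlim_minus (V := C_R_NormedModule)).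
Qed.

(** Only the boundary value at [t] survives: at the upper end [F] decays, and at the lower end
    [Rmax a t] is eventually [t]. *)
Lemma is_IntC_theta_derive_decay (t : R) : is_IntC (fun s => RtoC (theta (s - t)) * f s)%C (- F t)%C.
Proof.
  destruct (decay_lim F M HM) as [Lm Lp].
  replace (- F t)%C with (minus (G := C_R_NormedModule) (RtoC 0) (F t)) by (change (0 - F t = - F
      t)%C; ring).
  apply is_IntC_ext with (f := fun s => scal (V := C_R_NormedModule) (theta (s - t)) (f s)).
  { intros s. destruct (f s) as [f1 f2]. cbv -[theta Rmult Rplus Rminus Ropp]. f_equal; ring. }
  unfold is_IntC, is_RInt_gen.
  apply (filterlimi_lim_ext (fun ab => minus (G := C_R_NormedModule) (F (Rmax (snd ab) t)) (F (Rmax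
      (fst ab) t)))).
  - intros [a b]; simpl. apply (is_RInt_theta (V := C_R_CompleteNormedModule) f F); auto.
  - eapply (filterlim_comp_2 (G := locally (T := C_R_NormedModule) (RtoC 0))
      (H := locally (T := C_R_NormedModule) (F t)) (fun ab => F (Rmax (snd ab) t))
      (fun ab => F (Rmax (fst ab) t)) (minus (G := C_R_NormedModule))).
    + apply (filterlim_comp _ _ _ snd (fun y => F (Rmax y t)) _ (Rbar_locally p_infty)); [apply
        filterlim_snd|].
      eapply filterlim_ext_loc; [|exact Lp].
      exists t. intros y Hy. rewrite Rmax_left by lra. reflexivity.
    + apply (filterlim_comp _ _ _ fst (fun y => F (Rmax y t)) _ (Rbar_locally m_infty)); [apply
        filterlim_fst|].
      eapply filterlim_ext_loc; [|apply filterlim_const].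
      exists t. intros y Hy. rewrite Rmax_right by lra. reflexivity.
    + apply (filterlim_minus (V := C_R_NormedModule)).
Qed.

Lemma is_IntC_wsum_derive_decay m c wh x :
  is_IntC (fun s => RtoC (wsum m c wh x s) * f s)%C
    (- sumC m (fun k => RtoC (om wh k) * F (tt c x k)))%C.
Proof.
  unfold wsum. induction m as [|m IH]; simpl.
  - eapply is_IntC_val; [eapply is_IntC_ext; [|apply is_IntC_derive_decay]|].
    + intros s; simpl. rewrite Rplus_0_r. ring.
    + ring.
  - eapply is_IntC_val; [eapply is_IntC_ext; [|apply is_IntC_plus; [exact IH|
      apply (is_IntC_mult (RtoC (om wh (S m)))); apply (is_IntC_theta_derive_decay (tt c x (S
          m)))]]|].
    + intros s; simpl. rewrite !RtoC_plus, RtoC_mult. ring.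
    + ring.
Qed.
End byparts.

Lemma Cder_gauss (z : C) : Cder (fun w => cexp (- (w * w))%C) z (- (2 * z) * cexp (- (z * z)))%C.
Proof.
  eapply Cder_val.
  - apply (Cder_comp cexp (fun w => (- (w * w))%C)); [apply Cder_cexp|].
    eapply Cder_ext; [|apply Cder_mult; [apply (Cder_const (- RtoC 1)%C)|apply Cder_mult; apply
        Cder_id]].
    intros w; simpl. ring.
  - simpl. replace (RtoC 2) with (1 + 1)%C by (rewrite <- RtoC_plus; reflexivity). ring.
Qed.

Lemma gauss_R (s : R) : cexp (- (RtoC s * RtoC s))%C = RtoC (exp (- s ^ 2)).
Proof. rewrite <- RtoC_mult, <- RtoC_opp, cexp_R. do 2 f_equal. ring. Qed.

(** The antiderivative is g(z) exp(-z^2), and each step of the weight contributes its boundary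
    value. With g = 1 / (z - u) this yields the equation for [C0'], with g = P_n P_{n+1} the sum of
    the [rnk]. Derivatives are asked at real points only, because 1 / (z - u) has a pole off the
    line; differentiability of [dg] makes the integrand continuous apart from the steps. *)
Lemma weight_by_parts m c wh x (g dg : C -> C) (M : R) :
  (forall s : R, Cder g (RtoC s) (dg (RtoC s))) ->
  (forall s : R, exists l, Cder dg (RtoC s) l) ->
  (forall s : R, Cmod (g (RtoC s)) <= M * exp (s ^ 2 / 2)) ->
  is_IntC (fun s => (dg (RtoC s) - 2 * RtoC s * g (RtoC s)) * RtoC (weight m c wh x s))%C
    (- sumC m (fun k => RtoC (om wh k * exp (- (tt c x k) ^ 2)) * g (RtoC (tt c x k))))%C.
Proof.
  intros Hg Hdg HM.
  set (F := fun z : C => (g z * cexp (- (z * z)))%C).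
  set (f := fun z : C => ((dg z - 2 * z * g z) * cexp (- (z * z)))%C).
  assert (HF : forall s : R, Cder F (RtoC s) (f (RtoC s))).
  { intros s. eapply Cder_val; [apply Cder_mult; [apply Hg|apply Cder_gauss]|].
    unfold f. ring. }
  assert (Hf : forall s : R, exists l, Cder f (RtoC s) l).
  { intros s. destruct (Hdg s) as [l Hl]. eexists. apply Cder_mult; [|apply Cder_gauss].
    apply Cder_plus; [exact Hl|].
    eapply Cder_ext; [|apply Cder_mult; [apply Cder_mult;[apply (Cder_const (- RtoC 2)%C)|apply
        Cder_id]|apply Hg]].
    intros w; simpl. ring. }
  eapply is_IntC_val; [eapply is_IntC_ext; [|apply (is_IntC_wsum_derive_decay
     (fun s => F (RtoC s)) (fun s => f (RtoC s)) (2 * M)) with (m := m) (c := c) (wh := wh) (x :=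
         x)]|].
  - intros s; simpl. unfold f, weight. fold (wsum m c wh x s). rewrite gauss_R, RtoC_mult. ring.
  - intros s. apply (is_derive_R_of_Cder F), HF.
  - intros s. destruct (Hf s) as [l Hl]. apply (continuous_R_of_Cder f s l Hl).
  (* The growth bound leaves a factor exp(-s^2 / 2), and 1 + s^2 <= 2 exp(s^2 / 2); this gives the
     decay constant 2 M. *)
  - intros s. unfold F. rewrite gauss_R, Cmod_mult, Cmod_R.
    rewrite (Rabs_pos_eq (exp _)) by (left; apply exp_pos).
    specialize (HM s).
    assert (He : exp (- s ^ 2) * exp (s ^ 2 / 2) * exp (s ^ 2 / 2) = 1).
    { rewrite <- !exp_plus. rewrite <- exp_0. f_equal. field. }
    assert (H1 : 1 + s ^ 2 <= 2 * exp (s ^ 2 / 2)).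
    { pose proof (exp_ineq1_le (s ^ 2 / 2)). lra. }
    pose proof (exp_pos (- s ^ 2)). pose proof (exp_pos (s ^ 2 / 2)).
    pose proof (Cmod_ge_0 (g (RtoC s))).
    assert (0 <= s ^ 2) by nra.
    apply Rle_trans with ((M * exp (s ^ 2 / 2)) * exp (- s ^ 2) * (2 * exp (s ^ 2 / 2))); [|nra].
    apply Rmult_le_compat; try nra.
  - f_equal. clear. induction m as [|m IH]; simpl; [reflexivity|]. rewrite IH. f_equal.
    unfold F. rewrite gauss_R, RtoC_mult. simpl. ring.
Qed.

(** The steps telescope: when the first r are active they add up to omh r - omh 0, and omh 0 = 1 is
    the leading term of [wsum]. The last conjunct strengthens the induction: the points increase, so
    if the new step is active then all earlier ones are. *)
Lemma wsum_omh m c wh x (s : R) :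
  (forall k, (1 <= k)%nat -> (k < m)%nat -> c k < c (S k)) ->
  exists r, (r <= m)%nat /\ wsum m c wh x s = omh wh r /\
    ((1 <= m)%nat -> tt c x m < s -> r = m).
Proof.
  induction m as [|m IH]; intros Hc.
  - exists O. unfold wsum; simpl. repeat split; auto. ring.
  - destruct IH as [r [Hr [E Hm]]]; [intros; apply Hc; lia|].
    assert (Es : wsum (S m) c wh x s = wsum m c wh x s + om wh (S m) * theta (s - tt c x (S m))).
    { unfold wsum; simpl. ring. }
    destruct (Rlt_dec (tt c x (S m)) s) as [H|H].
    + assert (r = m).
      { destruct m as [|m']; [lia|]. apply Hm; [lia|]. unfold tt in *.
        specialize (Hc (S m') ltac:(lia) ltac:(lia)). lra. }
      subst r. exists (S m). repeat split; auto.
      rewrite Es, E, theta_1 by lra. unfold om; simpl. ring.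
    + exists r. repeat split; auto; try lia; [|intros; contradiction].
      rewrite Es, E, theta_0 by lra. ring.
Qed.

(** The increments [om] may be negative, so the sign is read off the telescoped value. *)
Lemma weight_ge_0 m c wh x (s : R) :
  (forall k, (1 <= k)%nat -> (k < m)%nat -> c k < c (S k)) ->
  (forall k, (1 <= k <= m)%nat -> 0 <= wh k) ->
  0 <= weight m c wh x s.
Proof.
  intros Hc Hw. destruct (wsum_omh m c wh x s Hc) as [r [Hr [E _]]].
  unfold weight. fold (wsum m c wh x s). rewrite E.
  apply Rmult_le_pos; [left; apply exp_pos|].
  destruct r; simpl; [lra|]. apply Hw; lia.
Qed.

Lemma Cmod_Im_le (u : C) (s : R) : Rabs (snd u) <= Cmod (RtoC s - u).
Proof.
  eapply Rle_trans; [|apply Rmax_Cmod]. eapply Rle_trans; [|apply Rmax_r].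
  simpl. rewrite <- (Rabs_Ropp (0 + _)). apply Req_le. f_equal. ring.
Qed.

Lemma Cminus_real_neq_0 (u : C) (s : R) : snd u <> 0 -> (RtoC s - u)%C <> 0.
Proof.
  intros Hu E. apply Hu. apply (f_equal snd) in E. simpl in E. lra.
Qed.

Lemma Cmod_inv_le (u : C) (s : R) : snd u <> 0 -> Cmod (/ (RtoC s - u)) <= / Rabs (snd u).
Proof.
  intros Hu. rewrite Cmod_inv by (apply Cminus_real_neq_0, Hu).
  apply Rinv_le_contravar; [apply Rabs_pos_lt, Hu|apply Cmod_Im_le].
Qed.

Lemma Cder_inv (u z : C) : (z - u)%C <> 0 -> Cder (fun w => / (w - u))%C z (- (/ (z - u) * / (z -
    u)))%C.
Proof.
  intros Hz. apply Cder_eps. intros eps He.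
  set (d := Cmod (z - u)). assert (Hd : 0 < d) by (apply Cmod_gt_0, Hz).
  (* The first radius keeps |w - u| >= d / 2; the remainder (w - z)^2 / ((z - u)^2 (w - u)) is then
     at most 2 |w - z|^2 / d^3, whence the second. *)
  exists (Rmin (d / 2) (eps * d ^ 3 / 2)). split.
  { apply Rmin_pos; [lra|]. apply Rdiv_lt_0_compat; [|lra]. apply Rmult_lt_0_compat; [lra|]. apply
      pow_lt, Hd. }
  intros w Hw.
  assert (H1 : Cmod (w - z) < d / 2) by (eapply Rlt_le_trans; [exact Hw|apply Rmin_l]).
  assert (H2 : Cmod (w - z) < eps * d ^ 3 / 2) by (eapply Rlt_le_trans; [exact Hw|apply Rmin_r]).
  assert (H3 : d / 2 <= Cmod (w - u)).
  { assert (d <= Cmod (w - u) + Cmod (w - z)).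
    { unfold d. rewrite <- (Cmod_opp (w - z)). eapply Rle_trans; [|apply Cmod_triangle].
      apply Req_le. f_equal. ring. } lra. }
  assert (Hwu : (w - u)%C <> 0) by (apply Cmod_gt_0; lra).
  replace (/ (w - u) - / (z - u) - (w - z) * - (/ (z - u) * / (z - u)))%C
    with ((w - z) * (w - z) * (/ (z - u) * / (z - u) * / (w - u)))%C by (field; auto).
  rewrite !Cmod_mult, !Cmod_inv by auto. fold d.
  assert (/ Cmod (w - u) <= 2 / d).
  { replace (2 / d) with (/ (d / 2)) by (field; lra). apply Rinv_le_contravar; lra. }
  pose proof (Cmod_ge_0 (w - z)).
  assert (0 < / d) by (apply Rinv_0_lt_compat, Hd).
  apply Rle_trans with (Cmod (w - z) * Cmod (w - z) * (/ d * / d * (2 / d))).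
  { repeat apply Rmult_le_compat_l; try nra. }
  rewrite Rmult_assoc. rewrite (Rmult_comm eps). apply Rmult_le_compat_l; auto.
  apply Rle_trans with (eps * d ^ 3 / 2 * (/ d * / d * (2 / d))).
  { apply Rmult_le_compat_r; [|lra]. apply Rmult_le_pos; [nra|]. apply Rdiv_le_0_compat; lra. }
  apply Req_le. field. lra.
Qed.

(** * The Cauchy transform of the weight *)

Definition jump (c wh : nat -> R) (x : R) (k : nat) : R :=
  om wh k * exp (- (tt c x k) ^ 2).

Lemma is_IntC_minus (f g : R -> C) (lf lg : C) : is_IntC f lf -> is_IntC g lg ->
  is_IntC (fun s => f s - g s)%C (lf - lg)%C.
Proof.
  intros Hf Hg.
  eapply is_IntC_val; [eapply is_IntC_ext; [|exact (is_IntC_plus _ _ _ _ Hf (is_IntC_mult (- RtoC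
      1)%C _ _ Hg))]|].
  - intros s; simpl; ring.
  - ring.
Qed.

Section resolvent.
Variables (m : nat) (c wh : nat -> R) (x h0 : R).
Let w := weight m c wh x.
Hypothesis w_ge_0 : forall s, 0 <= w s.
Hypothesis w_int : intR w h0.

Lemma resolvent_ex (u : C) : snd u <> 0 ->
  exists l, is_IntC (fun s => / (RtoC s - u) * RtoC (w s))%C l.
Proof.
  intros Hu.
  assert (Hw : forall s, w s = exp (- s ^ 2) * wsum m c wh x s) by reflexivity.
  apply (is_IntC_dominated _ (fun s => / Rabs (snd u) * w s) (/ Rabs (snd u) * h0)).
  - intros a b.
    set (f := fun z : C => (/ (z - u) * cexp (- (z * z)))%C).
    assert (Hf : forall s : R, continuous (U := C_R_NormedModule) (fun t => f (RtoC t)) s).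
    { intros s. eapply (continuous_R_of_Cder f). apply Cder_mult; [|apply Cder_gauss].
      apply Cder_inv, Cminus_real_neq_0, Hu. }
    eapply (ex_RInt_ext (V := C_R_NormedModule)); [|apply (ex_RInt_wsum (V :=
        C_R_CompleteNormedModule)
      (fun t => f (RtoC t)) m c wh x a b Hf)].
    intros s _. unfold f. rewrite gauss_R, Hw, RtoC_mult.
    destruct (/ (RtoC s - u))%C. cbv -[Rmult Rplus Rminus Ropp wsum exp pow]. f_equal; ring.
  - intros a b. apply (ex_RInt_scal (V := R_NormedModule)).
    eapply ex_RInt_ext; [|apply (ex_RInt_wsum (V := R_CompleteNormedModule)
      (fun s => exp (- s ^ 2)) m c wh x a b)].
    + intros s _. rewrite Hw. apply Rmult_comm.
    + intros s. apply (ex_derive_continuous (V := R_NormedModule)). auto_derive; auto.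
  - intros s. rewrite Cmod_mult, Cmod_R, Rabs_pos_eq by apply w_ge_0.
    apply Rmult_le_compat_r; [apply w_ge_0|]. apply Cmod_inv_le, Hu.
  - exact (is_RInt_gen_scal (V := R_NormedModule) w (/ Rabs (snd u)) h0 w_int).
Qed.

Definition resolvent (u : C) : C := IntC (fun s => / (RtoC s - u) * RtoC (w s))%C.

Lemma is_IntC_resolvent (u : C) : snd u <> 0 ->
  is_IntC (fun s => / (RtoC s - u) * RtoC (w s))%C (resolvent u).
Proof.
  intros Hu. destruct (resolvent_ex u Hu) as [l Hl]. unfold resolvent.
  rewrite (is_IntC_unique _ _ Hl). exact Hl.
Qed.

Definition poles (u : C) : C :=
  sumC m (fun k => RtoC (jump c wh x k) * / (RtoC (tt c x k) - u))%C.

(** The right side of the differential equation of [resolvent], taken as the candidate derivative;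
    integration by parts identifies it with the integral of w / (s - u)^2. *)
Definition dresolvent (u : C) : C := (poles u - 2 * u * resolvent u - 2 * RtoC h0)%C.

(** By parts with 1 / (s - u); then s / (s - u) = 1 + u / (s - u) produces the terms in [h0] and
    [resolvent]. *)
Lemma is_IntC_dresolvent (u : C) : snd u <> 0 ->
  is_IntC (fun s => / (RtoC s - u) * / (RtoC s - u) * RtoC (w s))%C (dresolvent u).
Proof.
  intros Hu.
  assert (Hn : forall s : R, (RtoC s - u)%C <> 0) by (intros; apply Cminus_real_neq_0, Hu).
  assert (IBP : is_IntC (fun s => (- (/ (RtoC s - u) * / (RtoC s - u)) - 2 * RtoC s * / (RtoC s -
      u)) * RtoC (w s))%C
    (- poles u)%C).
  { apply (weight_by_parts m c wh x (fun z => / (z - u))%C (fun z => - (/ (z - u) * / (z - u)))%C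
     (/ Rabs (snd u))).
    - intros s. apply Cder_inv, Hn.
    - intros s. eexists.
      eapply Cder_ext; [|apply Cder_mult; [apply (Cder_const (- RtoC 1)%C)|apply Cder_mult; apply
          (Cder_inv u), Hn]].
      intros; simpl; ring.
    - intros s. eapply Rle_trans; [apply Cmod_inv_le, Hu|].
      rewrite <- (Rmult_1_r (/ _)) at 1. apply Rmult_le_compat_l.
      + left. apply Rinv_0_lt_compat, Rabs_pos_lt, Hu.
      + pose proof (exp_ineq1_le (s ^ 2 / 2)). assert (0 <= s ^ 2) by nra. lra. }
  pose proof (is_IntC_mult (- RtoC 1)%C _ _ IBP) as K1.
  pose proof (is_IntC_mult (2 * u)%C _ _ (is_IntC_resolvent u Hu)) as K2.
  pose proof (is_IntC_mult 2 _ _ (is_IntC_RtoC _ _ w_int)) as K3.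
  eapply is_IntC_val; [eapply is_IntC_ext; [|exact (is_IntC_minus _ _ _ _ (is_IntC_minus _ _ _ _ K1
      K2) K3)]|].
  - intros s; simpl. field. apply Hn.
  - unfold dresolvent. ring.
Qed.

(** Differentiation under the integral is replaced by the exact remainder (v - u)^2 / ((s - u)^2 (s
    - v)) of the kernel, which is at most 2 |v - u|^2 / d^3 uniformly in [s] and is integrated
    against [w]. *)
Lemma Cder_resolvent (u : C) : snd u <> 0 -> Cder resolvent u (dresolvent u).
Proof.
  intros Hu. set (d := Rabs (snd u)). assert (Hd : 0 < d) by (apply Rabs_pos_lt, Hu).
  assert (Hh : 0 <= h0).
  { pose proof (is_IntC_norm _ _ _ _ (fun s => Req_le _ _ (eq_trans (Cmod_R (w s)) (Rabs_pos_eq _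
      (w_ge_0 s))))
      (is_IntC_RtoC _ _ w_int) w_int) as K. pose proof (Cmod_ge_0 (RtoC h0)). lra. }
  apply Cder_eps. intros eps He.
  (* The integrated remainder is at most 2 |v - u|^2 h0 / d^3; [h0 + 1] in place of [h0] keeps the
     radius meaningful when [h0] is 0. *)
  exists (Rmin (d / 2) (eps * d ^ 3 / (2 * (h0 + 1)))). split.
  { apply Rmin_pos; [lra|]. apply Rdiv_lt_0_compat; [|lra]. apply Rmult_lt_0_compat; [lra|]. apply
      pow_lt, Hd. }
  intros v Hv.
  assert (H1 : Cmod (v - u) < d / 2) by (eapply Rlt_le_trans; [exact Hv|apply Rmin_l]).
  assert (H2 : Cmod (v - u) < eps * d ^ 3 / (2 * (h0 + 1))) by (eapply Rlt_le_trans; [exact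
      Hv|apply Rmin_r]).
  assert (H3 : d / 2 <= Rabs (snd v)).
  { assert (Rabs (snd (v - u)%C) <= Cmod (v - u)).
    { eapply Rle_trans; [|apply Rmax_Cmod]. apply Rmax_r. }
    assert (d <= Rabs (snd v) + Rabs (snd (v - u)%C)).
    { unfold d. rewrite <- (Rabs_Ropp (snd (v - u)%C)). eapply Rle_trans; [|apply Rabs_triang].
      apply Req_le. f_equal. simpl. ring. } lra. }
  assert (Hv0 : snd v <> 0). { intros E. rewrite E, Rabs_R0 in H3. lra. }
  assert (Hnu : forall s : R, (RtoC s - u)%C <> 0) by (intros; apply Cminus_real_neq_0, Hu).
  assert (Hnv : forall s : R, (RtoC s - v)%C <> 0) by (intros; apply Cminus_real_neq_0, Hv0).
  pose proof (is_IntC_minus _ _ _ _ (is_IntC_minus _ _ _ _ (is_IntC_resolvent v Hv0)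
      (is_IntC_resolvent u Hu))
    (is_IntC_mult (v - u)%C _ _ (is_IntC_dresolvent u Hu))) as K.
  set (N := Cmod (v - u)) in *.
  assert (HN : 0 <= N) by apply Cmod_ge_0.
  eapply Rle_trans.
  { eapply is_IntC_norm; [|exact K|exact (is_RInt_gen_scal (V := R_NormedModule) w (N * N * (/ d *
      / d * (2 / d))) h0 w_int)].
    intros s. simpl.
    replace (/ (s - v) * w s - / (s - u) * w s - (v - u) * (/ (s - u) * / (s - u) * w s))%C
      with ((v - u) * (v - u) * (/ (s - u) * / (s - u) * / (s - v)) * w s)%C by (field; auto).
    rewrite !Cmod_mult. fold N. rewrite Cmod_R, Rabs_pos_eq by apply w_ge_0.
    apply Rmult_le_compat_r; [apply w_ge_0|].
    pose proof (Cmod_inv_le u s Hu). pose proof (Cmod_inv_le v s Hv0). fold d in H.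
    assert (/ Rabs (snd v) <= 2 / d).
    { replace (2 / d) with (/ (d / 2)) by (field; lra). apply Rinv_le_contravar; lra. }
    pose proof (Cmod_ge_0 (/ (s - u))). pose proof (Cmod_ge_0 (/ (s - v))).
    apply Rmult_le_compat_l; [nra|].
    repeat apply Rmult_le_compat; try nra. }
  unfold scal; simpl. unfold mult; simpl.
  apply Rle_trans with (N * (eps * d ^ 3 / (2 * (h0 + 1))) * (/ d * / d * (2 / d)) * h0).
  { apply Rmult_le_compat_r; auto. apply Rmult_le_compat_r.
    - assert (0 < / d) by (apply Rinv_0_lt_compat, Hd).
      assert (0 < 2 / d) by (apply Rdiv_lt_0_compat; lra). repeat apply Rmult_le_pos; lra.
    - apply Rmult_le_compat_l; lra. }
  replace (N * (eps * d ^ 3 / (2 * (h0 + 1))) * (/ d * / d * (2 / d)) * h0)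
    with (eps * N * (h0 / (h0 + 1))) by (field; lra).
  rewrite <- (Rmult_1_r (eps * N)) at 2. apply Rmult_le_compat_l; [nra|].
  apply Rmult_le_reg_r with (h0 + 1); [lra|]. unfold Rdiv. rewrite Rmult_assoc, Rinv_l; lra.
Qed.
End resolvent.

(** * Polynomials and orthogonality *)

Lemma pevalC_R (p : rpoly) (s : R) : pevalC p (RtoC s) = RtoC (pevalR p s).
Proof.
  induction p as [|a q IH]; simpl; [reflexivity|]. rewrite IH, RtoC_plus, RtoC_mult. reflexivity.
Qed.

(* Evaluates to [k q + z q'], so that [dpoly1 1 q] is the derivative of [a :: q]. *)
Fixpoint dpoly1 (k : nat) (q : rpoly) : rpoly :=
  match q with nil => nil | a :: q' => (INR k * a) :: dpoly1 (S k) q' end.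
Definition dpoly (p : rpoly) : rpoly := dpoly1 1 (tl p).

Lemma length_dpoly1 k q : length (dpoly1 k q) = length q.
Proof. revert k. induction q; intros; simpl; auto. Qed.

Lemma nth_dpoly1 k q i : nth i (dpoly1 k q) 0 = INR (k + i) * nth i q 0.
Proof.
  revert k i. induction q as [|a q IH]; intros k [|i]; try (cbn [dpoly1 nth]; ring).
  - cbn [dpoly1 nth]. rewrite Nat.add_0_r. reflexivity.
  - cbn [dpoly1 nth]. rewrite IH. do 2 f_equal. lia.
Qed.

Lemma pevalC_dpoly1_S k q z : pevalC (dpoly1 (S k) q) z = (pevalC q z + pevalC (dpoly1 k q) z)%C.
Proof.
  revert k. induction q as [|a q IH]; intros k; cbn [dpoly1 pevalC]; [ring|].
  rewrite IH, S_INR, !RtoC_mult, RtoC_plus. ring.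
Qed.

Lemma Cder_pevalC (p : rpoly) (z : C) : Cder (pevalC p) z (pevalC (dpoly p) z).
Proof.
  induction p as [|a q IH].
  - apply Cder_const.
  - unfold dpoly; simpl.
    eapply Cder_val; [apply Cder_plus; [apply Cder_const|apply Cder_mult; [apply Cder_id|exact IH]]|].
    destruct q as [|b q]; unfold dpoly; cbn [dpoly1 pevalC tl]; [ring|].
    rewrite (pevalC_dpoly1_S 1). simpl INR. rewrite Rmult_1_l. ring.
Qed.

(** Stated for every [e] because the induction halves it: multiplication by [s] costs a factor (1 +
    2 / e) exp(e s^2 / 2). *)
Lemma pevalR_growth (p : rpoly) (e : R) : 0 < e ->
  exists M, 0 <= M /\ forall s, Rabs (pevalR p s) <= M * exp (e * s ^ 2).
Proof.
  revert e. induction p as [|a q IH]; intros e He; simpl pevalR.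
  - exists 0. split; [lra|]. intros s. rewrite Rabs_R0. lra.
  - destruct (IH (e / 2)) as [M [HM H]]; [lra|].
    exists (Rabs a + (1 + 2 / e) * M).
    assert (0 < 2 / e) by (apply Rdiv_lt_0_compat; lra).
    split; [pose proof (Rabs_pos a); nra|]. intros s.
    assert (0 <= s ^ 2) by nra.
    assert (E : exp (e * s ^ 2) = exp (e / 2 * s ^ 2) * exp (e / 2 * s ^ 2)).
    { rewrite <- exp_plus. f_equal. field. }
    set (X := exp (e / 2 * s ^ 2)) in *.
    assert (HX : 1 + e / 2 * s ^ 2 <= X) by apply exp_ineq1_le.
    assert (Hs : Rabs s <= (1 + 2 / e) * X).
    { assert (Rabs s <= 1 + s ^ 2) by (rewrite <- (pow2_abs s); pose proof (Rabs_pos s); nra).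
      assert (2 / e * (e / 2 * s ^ 2) = s ^ 2) by (field; lra). nra. }
    assert (1 <= X) by nra.
    eapply Rle_trans; [apply Rabs_triang|]. rewrite Rabs_mult, E.
    specialize (H s). fold X in H.
    assert (Rabs s * Rabs (pevalR q s) <= ((1 + 2 / e) * X) * (M * X)).
    { apply Rmult_le_compat; auto using Rabs_pos. }
    pose proof (Rabs_pos a). assert (Rabs a * 1 <= Rabs a * (X * X)) by (apply Rmult_le_compat_l;
        nra). nra.
Qed.

(** Division by a monic polynomial of the same formal degree; iterated, it expands any polynomial in
    the family [P]. *)
Lemma monic_reduce l (r p : rpoly) : length r = S l -> length p = S l -> nth l p 0 = 1 ->
  exists r', length r' = l /\ forall s, pevalR r s = nth l r 0 * pevalR p s + pevalR r' s.
Proof.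
  revert r p. induction l as [|l IH]; intros [|a r] [|b p] Hr Hp Hn; try discriminate.
  - destruct r, p; try discriminate. simpl in *. exists nil. split; auto. intros; simpl. subst b.
      ring.
  - destruct (IH r p) as [r' [Hl H]]; [simpl in *; lia..|exact Hn|].
    exists ((a - nth l r 0 * b) :: r'). split; [simpl; lia|]. intros s. simpl. rewrite H. ring.
Qed.

Section orthogonal.
Variables (w : R -> R) (P : nat -> rpoly) (h : nat -> R).
Hypothesis OP : is_OP_family w P h.

(** [is_OP_family] speaks only of products of two members. As [P 0] is 1, convergence for [P l] is
    the case k = 0, and expansion in the family gives all polynomials. *)
Lemma op_moment (r : rpoly) : exists l, intR (fun s => pevalR r s * w s) l.
Proof.
  destruct OP as [HP [_ HI]]. remember (length r) as l eqn:Hl. symmetry in Hl.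
  revert r Hl. induction l as [|l IH]; intros r Hl.
  - destruct r; [|discriminate]. exists 0. eapply intR_ext; [|apply intR_zero]. intros; simpl; ring.
  - destruct (HP l) as [H1 H2].
    destruct (monic_reduce l r (P l) Hl H1 H2) as [r' [Hl' Hr']].
    destruct (IH r' Hl') as [v Hv].
    eexists. eapply intR_ext; [|exact (intR_lin _ _ (nth l r 0) 1 _ _ (HI l O) Hv)].
    intros s; simpl. rewrite Hr'.
    destruct (HP O) as [L0 N0]. destruct (P O) as [|a [|]]; try discriminate. simpl in *. subst a.
        ring.
Qed.

(** [length r <= j] means degree below j, so the expansion of [r] uses only [P l] with l < j. *)
Lemma op_orthogonal j (r : rpoly) : (length r <= j)%nat ->
  intR (fun s => pevalR (P j) s * pevalR r s * w s) 0.
Proof.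
  destruct OP as [HP [_ HI]]. remember (length r) as l eqn:Hl. symmetry in Hl.
  revert r Hl. induction l as [|l IH]; intros r Hl Hj.
  - destruct r; [|discriminate]. eapply intR_ext; [|apply intR_zero]. intros; simpl; ring.
  - destruct (HP l) as [H1 H2].
    destruct (monic_reduce l r (P l) Hl H1 H2) as [r' [Hl' Hr']].
    pose proof (intR_lin _ _ (nth l r 0) 1 _ _ (HI j l) (IH r' Hl' ltac:(lia))) as K.
    destruct (Nat.eqb_spec j l); [lia|].
    rewrite !Rmult_0_r, Rplus_0_r in K. eapply intR_ext; [|exact K].
    intros s; simpl. rewrite Hr'. ring.
Qed.

Lemma op_norm j (r : rpoly) : length r = S j ->
  intR (fun s => pevalR (P j) s * pevalR r s * w s) (nth j r 0 * h j).
Proof.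
  intros Hl. destruct OP as [HP [_ HI]]. destruct (HP j) as [H1 H2].
  destruct (monic_reduce j r (P j) Hl H1 H2) as [r' [Hl' Hr']].
  pose proof (intR_lin _ _ (nth j r 0) 1 _ _ (HI j j) (op_orthogonal j r' ltac:(lia))) as K.
  rewrite Nat.eqb_refl, Rmult_0_r, Rplus_0_r in K. eapply intR_ext; [|exact K].
  intros s; simpl. rewrite Hr'. ring.
Qed.

(** The divided difference (p(s) - p(u)) / (s - u) in Horner form: a polynomial, hence defined at s
    = u too, whose degree in [s] is one less than that of [p]. *)
Fixpoint ddiff (p : rpoly) (s u : C) : C :=
  match p with nil => RtoC 0 | a :: q => (pevalC q s + u * ddiff q s u)%C end.

Lemma ddiff_spec (p : rpoly) (s u : C) : ((s - u) * ddiff p s u = pevalC p s - pevalC p u)%C.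
Proof.
  induction p as [|a q IH]; simpl; [ring|].
  replace ((s - u) * (pevalC q s + u * ddiff q s u))%C
    with ((s - u) * pevalC q s + u * ((s - u) * ddiff q s u))%C by ring.
  rewrite IH. ring.
Qed.

(** The associated polynomial, or polynomial of the second kind: the integral of [ddiff p s u * w s]
    over [s], as a polynomial in [u]. It is [D_f] of the overview. *)
Fixpoint assoc_poly (p : rpoly) : rpoly :=
  match p with
  | nil => nil
  | a :: q => RInt_gen (fun s => pevalR q s * w s) (Rbar_locally m_infty) (Rbar_locally p_infty)
              :: assoc_poly q
  end.

Lemma is_IntC_assoc_poly (p : rpoly) (u : C) :
  is_IntC (fun s => ddiff p (RtoC s) u * RtoC (w s))%C (pevalC (assoc_poly p) u).
Proof.
  induction p as [|a q IH]; simpl.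
  - eapply is_IntC_ext; [|apply (is_IntC_RtoC _ _ intR_zero)]. intros; simpl; ring.
  - destruct (op_moment q) as [l Hl].
    rewrite (is_RInt_gen_unique (V := R_CompleteNormedModule) _ _ Hl).
    eapply is_IntC_ext; [|exact (is_IntC_plus _ _ _ _ (is_IntC_RtoC _ _ Hl) (is_IntC_mult u _ _ IH))].
    intros s; simpl. rewrite pevalC_R, RtoC_mult. ring.
Qed.

Lemma cauchy_pevalR (p : rpoly) (u c0 : C) : snd u <> 0 ->
  is_IntC (fun s => / (RtoC s - u) * RtoC (w s))%C c0 ->
  Defs.cauchy (pevalR p) w u = (pevalC p u * c0 + pevalC (assoc_poly p) u)%C.
Proof.
  intros Hu H0. unfold Defs.cauchy. apply is_IntC_unique.
  eapply is_IntC_ext; [|exact (is_IntC_plus _ _ _ _ (is_IntC_mult (pevalC p u) _ _ H0)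
      (is_IntC_assoc_poly p u))].
  intros s; simpl. assert (Hn := Cminus_real_neq_0 u s Hu).
  assert (E : ddiff p s u = ((pevalC p s - pevalC p u) / (s - u))%C).
  { rewrite <- ddiff_spec. field. exact Hn. }
  rewrite E, pevalC_R, RtoC_mult. field. exact Hn.
Qed.

(** The divided difference lowers the degree by one; hence the bound [S j] on the length where
    [op_orthogonal] has [j]. *)
Lemma op_ddiff_orthogonal j (r : rpoly) (u : C) : (length r <= S j)%nat ->
  is_IntC (fun s => RtoC (pevalR (P j) s) * ddiff r (RtoC s) u * RtoC (w s))%C 0.
Proof.
  induction r as [|a q IH]; intros Hl; simpl in *.
  - eapply is_IntC_ext; [|apply (is_IntC_RtoC _ _ intR_zero)]. intros; simpl; ring.
  - eapply is_IntC_val; [eapply is_IntC_ext; [|exact (is_IntC_plus _ _ _ _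
      (is_IntC_RtoC _ _ (op_orthogonal j q ltac:(lia))) (is_IntC_mult u _ _ (IH ltac:(lia))))]|].
    + intros s; simpl. rewrite pevalC_R, !RtoC_mult. ring.
    + ring.
Qed.

Lemma op_ddiff_norm j (r : rpoly) (u : C) : length r = S (S j) ->
  is_IntC (fun s => RtoC (pevalR (P j) s) * ddiff r (RtoC s) u * RtoC (w s))%C
    (RtoC (nth (S j) r 0 * h j)).
Proof.
  destruct r as [|a q]; intros Hl; simpl in *; [discriminate|].
  eapply is_IntC_val; [eapply is_IntC_ext; [|exact (is_IntC_plus _ _ _ _
      (is_IntC_RtoC _ _ (op_norm j q ltac:(lia))) (is_IntC_mult u _ _ (op_ddiff_orthogonal j q u
          ltac:(lia))))]|].
    + intros s; simpl. rewrite pevalC_R, !RtoC_mult. ring.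
    + ring.
Qed.

(** With d_n, d_{n+1} the divided differences of P_n, P_{n+1}, the integrands P_n(u) d_{n+1} -
    P_{n+1}(u) d_n and P_n(s) d_{n+1} - P_{n+1}(s) d_n are equal: both are (P_n(u) P_{n+1}(s) -
    P_{n+1}(u) P_n(s)) / (s - u). In the second form orthogonality leaves only h_n, from the leading
    term of d_{n+1}. *)
Lemma assoc_poly_wronskian n (u : C) : snd u <> 0 ->
  (pevalC (P n) u * pevalC (assoc_poly (P (S n))) u
   - pevalC (P (S n)) u * pevalC (assoc_poly (P n)) u)%C = RtoC (h n).
Proof.
  intros Hu. destruct OP as [HP _]. destruct (HP n) as [L1 N1]. destruct (HP (S n)) as [L2 N2].
  pose proof (is_IntC_minus _ _ _ _ (is_IntC_mult (pevalC (P n) u) _ _ (is_IntC_assoc_poly (P (S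
      n)) u))
    (is_IntC_mult (pevalC (P (S n)) u) _ _ (is_IntC_assoc_poly (P n) u))) as K1.
  pose proof (is_IntC_minus _ _ _ _ (op_ddiff_norm n (P (S n)) u L2)
    (op_ddiff_orthogonal (S n) (P n) u ltac:(lia))) as K2.
  rewrite N2 in K2.
  replace (RtoC (h n)) with (1 * h n - 0)%C by ring. rewrite <- RtoC_mult.
  refine (is_IntC_eq _ _ _ K1 _). eapply is_IntC_ext; [|exact K2].
  intros s; simpl. rewrite <- !pevalC_R.
  assert (Hn := Cminus_real_neq_0 u s Hu).
  assert (E : forall p, ddiff p s u = ((pevalC p s - pevalC p u) / (s - u))%C).
  { intros p. rewrite <- ddiff_spec. field. exact Hn. }
  rewrite !E. field. exact Hn.
Qed.
End orthogonal.

(** The three terms of the integrated derivative give 0, since P_n' has degree below n + 1; (n + 1)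
    h_n, from the leading coefficient of P_{n+1}'; and 2 h_{n+1}, since s P_n is monic of degree n +
    1. Here [S n] is the index called n in the theorem. *)
Lemma op_string_equation m c wh x P h n : is_OP_family (weight m c wh x) P h ->
  (RtoC (INR (S n)) + sumC m (fun k => RtoC (rnk m c wh x P h (S n) k)))%C = RtoC (2 * h (S n) / h n).
Proof.
  intros OP. pose proof OP as OP'. destruct OP' as [HP [Hh _]]. specialize (Hh n).
  destruct (HP n) as [L1 N1]. destruct (HP (S n)) as [L2 N2].
  set (w := weight m c wh x) in *.
  (* Two factors of growth exp(s^2 / 4) make up the exp(s^2 / 2) allowed by [weight_by_parts]. *)
  destruct (pevalR_growth (P n) (1/4) ltac:(lra)) as [M1 [HM1 G1]].
  destruct (pevalR_growth (P (S n)) (1/4) ltac:(lra)) as [M2 [HM2 G2]].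
  pose proof (weight_by_parts m c wh x (fun z => pevalC (P n) z * pevalC (P (S n)) z)%C
    (fun z => pevalC (dpoly (P n)) z * pevalC (P (S n)) z + pevalC (P n) z * pevalC (dpoly (P (S
        n))) z)%C
    (M1 * M2)
    (fun s => Cder_mult _ _ _ _ _ (Cder_pevalC _ _) (Cder_pevalC _ _))
    (fun s => ex_intro _ _ (Cder_plus _ _ _ _ _
       (Cder_mult _ _ _ _ _ (Cder_pevalC _ (RtoC s)) (Cder_pevalC _ (RtoC s)))
       (Cder_mult _ _ _ _ _ (Cder_pevalC _ (RtoC s)) (Cder_pevalC _ (RtoC s)))))) as K.
  fold w in K.
  assert (K' := K ltac:(
    intros s; cbv beta; rewrite !pevalC_R, Cmod_mult, !Cmod_R;
    replace (exp (s ^ 2 / 2)) with (exp (1 / 4 * s ^ 2) * exp (1 / 4 * s ^ 2))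
      by (rewrite <- exp_plus; f_equal; field);
    replace (M1 * M2 * (exp (1 / 4 * s ^ 2) * exp (1 / 4 * s ^ 2))) with
      ((M1 * exp (1 / 4 * s ^ 2)) * (M2 * exp (1 / 4 * s ^ 2))) by ring;
    apply Rmult_le_compat; auto using Rabs_pos)). clear K.
  assert (I1 := op_orthogonal w P h OP (S n) (dpoly (P n)) ltac:(
    unfold dpoly; rewrite length_dpoly1; destruct (P n); simpl in *; lia)).
  assert (I2 := op_norm w P h OP n (dpoly (P (S n))) ltac:(
    unfold dpoly; rewrite length_dpoly1; destruct (P (S n)); simpl in *; lia)).
  assert (I3 := op_norm w P h OP (S n) (0 :: P n) ltac:(simpl; lia)).
  cbn [nth] in I3. rewrite N1 in I3. unfold dpoly in I2 at 2. rewrite nth_dpoly1 in I2.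
  replace (nth n (tl (P (S n))) 0) with 1 in I2 by (destruct (P (S n)); [discriminate|]; simpl in
      *; auto).
  pose proof (is_IntC_minus _ _ _ _ (is_IntC_plus _ _ _ _ (is_IntC_RtoC _ _ I1) (is_IntC_RtoC _ _ I2))
    (is_IntC_mult 2 _ _ (is_IntC_RtoC _ _ I3))) as K2.
  eassert (E : _ = _).
  { refine (is_IntC_eq _ _ _ K' _). eapply is_IntC_ext; [|exact K2].
    intros s; cbn [pevalR]; cbv beta. rewrite !pevalC_R, !RtoC_mult, !RtoC_plus, !RtoC_mult. ring. }
  assert (ES : sumC m (fun k => RtoC (rnk m c wh x P h (S n) k)) =
    (sumC m (fun k => RtoC (om wh k * exp (- tt c x k ^ 2)) * (pevalC (P n) (RtoC (tt c x k)) *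
        pevalC (P (S n)) (RtoC (tt c x k)))) / RtoC (h n))%C).
  { assert (Hn : RtoC (h n) <> 0) by (intros E0; apply RtoC_inj in E0; lra).
    clear - Hn Hh. unfold rnk. induction m as [|m IH]; cbn [sumC]; [field; auto|].
    rewrite IH. cbn [Init.Nat.pred].
    rewrite !pevalC_R, RtoC_div by lra. rewrite !RtoC_mult. field. auto. }
  rewrite ES. set (S0 := sumC m _) in *.
  assert (Hn : RtoC (h n) <> 0) by (intros E0; apply RtoC_inj in E0; lra).
  rewrite RtoC_div, RtoC_mult by lra.
  assert (E2 : S0 = (2 * h (S n) - INR (S n) * h n)%C).
  { replace S0 with (- - S0)%C by ring. rewrite E, !RtoC_mult. change (1 + n)%nat with (S n). ring. }
  rewrite E2. field. exact Hn.
Qed.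

(** * Residues and behaviour at infinity *)

(** The disc of radius |Im z| around [z] misses the line. This matters because the closed form of
    [Phi] is available only off the line. *)
Lemma Cder_ext_off_real (f g : C -> C) (z l : C) : snd z <> 0 ->
  (forall v : C, snd v <> 0 -> f v = g v) -> Cder f z l -> Cder g z l.
Proof.
  intros Hz E H. apply Cder_eps. intros eps He.
  destruct (Cder_lim f z l H eps He) as [d [Hd Hf]].
  exists (Rmin d (Rabs (snd z))). split; [apply Rmin_pos; auto; apply Rabs_pos_lt, Hz|].
  intros v Hv. rewrite <- !E; auto.
  - apply Hf. eapply Rlt_le_trans; [exact Hv|apply Rmin_l].
  - intros E0. assert (H1 : Cmod (v - z) < Rabs (snd z)) by (eapply Rlt_le_trans; [exact Hv|apply
      Rmin_r]).
    apply (Rlt_irrefl (Rabs (snd z))). eapply Rle_lt_trans; [|exact H1].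
    eapply Rle_trans; [|apply Rmax_Cmod]. eapply Rle_trans; [|apply Rmax_r].
    simpl. rewrite E0, Rplus_0_l, Rabs_Ropp. lra.
Qed.

(** Approach [r] along r + i t. The difference D vanishes there, so differentiability bounds |D(r)|
    by t (1 + |D'(r)|), and [t] is chosen to make this at most |D(r)| / 2. *)
Lemma eq_at_real (f g : C -> C) (r : R) :
  (exists l, Cder f (RtoC r) l) -> (exists l, Cder g (RtoC r) l) ->
  (forall v : C, snd v <> 0 -> f v = g v) -> f (RtoC r) = g (RtoC r).
Proof.
  intros [l Hl] [l' Hl'] E.
  set (D := fun v => (f v + - RtoC 1 * g v)%C).
  assert (HD : exists l, Cder D (RtoC r) l).
  { eexists. apply Cder_plus; [exact Hl|]. apply Cder_mult; [apply Cder_const|exact Hl']. }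
  destruct HD as [l0 HD].
  destruct (Cder_lim D (RtoC r) l0 HD 1 Rlt_0_1) as [d [Hd K]].
  assert (Z : Cmod (D (RtoC r)) = 0).
  { apply Rle_antisym; [|apply Cmod_ge_0]. apply Rnot_lt_le. intros Hpos.
    pose proof (Cmod_ge_0 l0).
    set (t := Rmin (d / 2) (Cmod (D (RtoC r)) / (2 * (1 + Cmod l0)))).
    assert (Ht : 0 < t). { apply Rmin_pos; [lra|]. apply Rdiv_lt_0_compat; lra. }
    assert (Ht1 : t <= d / 2) by apply Rmin_l.
    assert (Ht2 : t <= Cmod (D (RtoC r)) / (2 * (1 + Cmod l0))) by apply Rmin_r.
    assert (Ht3 : t * (1 + Cmod l0) <= Cmod (D (RtoC r)) / 2).
    { replace (Cmod (D r) / 2) with (Cmod (D (RtoC r)) / (2 * (1 + Cmod l0)) * (1 + Cmod l0)) by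
        (field; lra).
      apply Rmult_le_compat_r; lra. }
    set (v := (RtoC r + (0, t))%C).
    assert (Ev : (v - RtoC r = (0, t))%C) by (unfold v; ring).
    assert (Mv : Cmod (0, t) = t).
    { unfold Cmod; simpl. replace (0 * (0 * 1) + t * (t * 1)) with (t * t) by ring. apply
        sqrt_square; lra. }
    specialize (K v). rewrite Ev, Mv in K. specialize (K ltac:(lra)).
    assert (Dv : D v = 0). { unfold D. rewrite E; [ring|]. unfold v; simpl. lra. }
    rewrite Dv in K.
    assert (Cmod (D (RtoC r)) <= Cmod (0 - D (RtoC r) - (0, t) * l0) + Cmod ((0, t) * l0)).
    { rewrite <- (Cmod_opp (D _)). eapply Rle_trans; [|apply Cmod_triangle]. apply Req_le. f_equal.
        ring. }
    rewrite (Cmod_mult (0, t)), Mv in H0. nra. }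
  apply Cmod_eq_0 in Z. unfold D in Z.
  replace (f (RtoC r)) with (f r + - RtoC 1 * g r + g r)%C by ring. rewrite Z. ring.
Qed.

Lemma Cder_sumC (m : nat) (F : nat -> C -> C) (z : C) :
  (forall k, (1 <= k <= m)%nat -> exists l, Cder (F k) z l) ->
  exists l, Cder (fun v => sumC m (fun k => F k v)) z l.
Proof.
  induction m as [|m IH]; intros H; simpl.
  - exists 0. apply Cder_const.
  - destruct IH as [l Hl]; [intros; apply H; lia|]. destruct (H (S m)) as [l' Hl']; [lia|].
    exists (l + l')%C. apply Cder_plus; assumption.
Qed.

Lemma sumC_ext m (f g : nat -> C) : (forall k, (1 <= k <= m)%nat -> f k = g k) -> sumC m f = sumC m g.
Proof.
  induction m as [|m IH]; intros H; simpl; [reflexivity|].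
  rewrite IH, H; auto; try lia. intros; apply H; lia.
Qed.

Lemma sumC_scal m (a : C) (f : nat -> C) : sumC m (fun k => a * f k)%C = (a * sumC m f)%C.
Proof. induction m as [|m IH]; simpl; [ring|]. rewrite IH. ring. Qed.

Lemma sumC_isolate m k (f : nat -> C) : (1 <= k <= m)%nat ->
  sumC m f = (f k + sumC m (fun j => if Nat.eqb j k then 0 else f j))%C.
Proof.
  induction m as [|m IH]; intros Hk; [lia|]. simpl.
  destruct (Nat.eq_dec k (S m)) as [->|Hne].
  - rewrite Nat.eqb_refl. rewrite (sumC_ext m (fun j => if (j =? S m)%nat then 0 else f j) f);
      [ring|].
    intros j Hj. destruct (Nat.eqb_spec j (S m)); [lia|reflexivity].
  - rewrite IH by lia. destruct k as [|k]; [lia|].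
    replace (m =? k)%nat with false by (symmetry; apply Nat.eqb_neq; lia). ring.
Qed.

Lemma Cder_partial_fractions m (c : nat -> R) (k : nat) (mu : nat -> C) :
  (forall j, (1 <= j <= m)%nat -> j <> k -> c j <> c k) ->
  exists l, Cder (fun z => sumC m (fun j => if Nat.eqb j k then 0 else mu j * / (z - RtoC (c j)))%C)
    (RtoC (c k)) l.
Proof.
  intros Hc. apply (Cder_sumC m (fun j z => if Nat.eqb j k then 0 else mu j * / (z - RtoC (c j)))%C).
  intros j Hj. destruct (Nat.eqb_spec j k).
  - exists 0. apply Cder_const.
  - eexists. apply Cder_mult; [apply Cder_const|]. apply Cder_inv.
    intros E. rewrite <- RtoC_minus in E. apply RtoC_inj in E. apply (Hc j Hj n). lra.
Qed.

(* After multiplication by [z - c k] both sides are differentiable at [c k]; they agree off the real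
   line, hence at [c k]. *)
Lemma residue_eq m (c : nat -> R) (k : nat) (mu rho : nat -> C) (B Q1 Q2 : C -> C) :
  (1 <= k <= m)%nat ->
  (forall j, (1 <= j <= m)%nat -> j <> k -> c j <> c k) ->
  (forall r : R, exists l, Cder B (RtoC r) l) ->
  (forall r : R, exists l, Cder Q1 (RtoC r) l) -> (forall r : R, exists l, Cder Q2 (RtoC r) l) ->
  (forall z : C, snd z <> 0 ->
     (Q1 z + sumC m (fun j => mu j * / (z - RtoC (c j))))%C =
     (B z * sumC m (fun j => rho j * / (z - RtoC (c j))) + Q2 z)%C) ->
  mu k = (B (RtoC (c k)) * rho k)%C.
Proof.
  intros Hk Hc HB HQ1 HQ2 H.
  destruct (HB (c k)) as [lB HlB]. destruct (HQ1 (c k)) as [lQ1 HlQ1]. destruct (HQ2 (c k)) as [lQ2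
      HlQ2].
  set (S1 := fun z => sumC m (fun j => if Nat.eqb j k then 0 else mu j * / (z - RtoC (c j)))%C).
  set (S2 := fun z => sumC m (fun j => if Nat.eqb j k then 0 else rho j * / (z - RtoC (c j)))%C).
  destruct (Cder_partial_fractions m c k mu Hc) as [l1 Hl1]. fold S1 in Hl1.
  destruct (Cder_partial_fractions m c k rho Hc) as [l2 Hl2]. fold S2 in Hl2.
  assert (Hid : Cder (fun z => z + - RtoC (c k))%C (RtoC (c k)) (1 + 0)%C)
    by (apply Cder_plus; [apply Cder_id|apply Cder_const]).
  pose proof (eq_at_real
    (fun z => mu k + (z + - RtoC (c k)) * (Q1 z + S1 z))%C
    (fun z => B z * (rho k + (z + - RtoC (c k)) * S2 z) + (z + - RtoC (c k)) * Q2 z)%C (c k)) as K.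
  cbv beta in K.
  replace (mu k) with (mu k + (c k + - c k) * (Q1 (c k) + S1 (c k)))%C by ring.
  rewrite K; [ring|..].
  - eexists. apply Cder_plus; [apply Cder_const|]. apply Cder_mult; [exact Hid|]. apply Cder_plus;
      eassumption.
  - eexists. apply Cder_plus.
    + apply Cder_mult; [exact HlB|]. apply Cder_plus; [apply Cder_const|]. apply Cder_mult; [exact
        Hid|exact Hl2].
    + apply Cder_mult; [exact Hid|exact HlQ2].
  - intros z Hz. specialize (H z Hz).
    rewrite (sumC_isolate m k (fun j => mu j * / (z - c j))%C Hk) in H.
    rewrite (sumC_isolate m k (fun j => rho j * / (z - c j))%C Hk) in H.
    cbv beta in H. fold (S1 z) in H. fold (S2 z) in H.
    assert (Hn : (z - c k)%C <> 0).
    { intros E. apply Hz. apply (f_equal snd) in E. simpl in E. lra. }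
    replace (mu k + (z + - c k) * (Q1 z + S1 z))%C with ((z - c k) * (Q1 z + (mu k * / (z - c k) +
        S1 z)))%C by (field; exact Hn).
    rewrite H. field. exact Hn.
Qed.

(** [F] is the reversed polynomial z^l p(1/z). When [p] has degree below l its value at 0 is 0,
    supplied by the default of [nth]. *)
Lemma pevalC_at_infinity (p : rpoly) l : (length p <= S l)%nat ->
  exists F : C -> C, (forall z, exists d, Cder F z d) /\ F 0 = RtoC (nth l p 0) /\
    forall z : C, z <> RtoC 0 -> (pevalC p (/ z) * z ^ l)%C = F z.
Proof.
  revert l. induction p as [|a q IH]; intros l Hl.
  - exists (fun _ => 0). split; [|split].
    + intros z. exists 0. apply Cder_const.
    + destruct l; reflexivity.
    + intros z _. simpl. ring.
  - destruct l as [|l].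
    + destruct q; [|simpl in Hl; lia]. exists (fun _ => RtoC a). split; [|split].
      * intros z. exists 0. apply Cder_const.
      * reflexivity.
      * intros z _. simpl. ring.
    + destruct (IH l) as [F [HF [F0 FE]]]; [simpl in Hl; lia|].
      assert (Hpow : forall j z, exists d, Cder (fun z => z ^ j)%C z d).
      { intros j z. induction j as [|j [d Hd]].
        - exists 0. apply (Cder_ext (fun _ => RtoC 1)); [intros; reflexivity|apply Cder_const].
        - eexists. apply (Cder_ext (fun z => z * z ^ j)%C); [intros; reflexivity|].
          apply Cder_mult; [apply Cder_id|exact Hd]. }
      exists (fun z => a * z ^ S l + F z)%C. split; [|split].
      * intros z. destruct (HF z) as [d Hd]. destruct (Hpow (S l) z) as [d' Hd'].
        eexists. apply Cder_plus; [|exact Hd]. apply Cder_mult; [apply Cder_const|exact Hd'].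
      * simpl. rewrite F0. ring.
      * intros z Hz. rewrite <- FE by exact Hz. simpl. field. exact Hz.
Qed.

(* The substitution [u = 1 / z] turns the leading coefficients into values at [z = 0]. *)
Lemma leading_coefficient_eq m (t : nat -> R) N (p p1 q : rpoly) (kap y e : C) (mu nu : nat -> C) :
  length p = S N -> nth N p 0 = 1 -> length q = S (S N) -> nth (S N) q 0 = 1 -> (length p1 <= S
      N)%nat ->
  (forall u : C, snd u <> 0 ->
    (kap * pevalC p1 u = kap * ((2 * u + sumC m (fun k => mu k * / (u - RtoC (t k)))) * pevalC p u)
       + (y + sumC m (fun k => nu k * / (u - RtoC (t k)))) * (e * pevalC q u))%C) ->
  (2 * kap + y * e = 0)%C.
Proof.
  intros Lp Np Lq Nq Lp1 H.
  destruct (pevalC_at_infinity p N ltac:(lia)) as [Fp [Dp [Zp Ep]]].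
  destruct (pevalC_at_infinity q (S N) ltac:(lia)) as [Fq [Dq [Zq Eq]]].
  (* [p1] is reversed at degree N + 1, above its own, so that the whole equation is multiplied by
     the same power of z; its value at 0 is therefore 0. *)
  destruct (pevalC_at_infinity p1 (S N) ltac:(lia)) as [F1 [D1 [Z1 E1]]].
  rewrite Np in Zp. rewrite Nq in Zq. rewrite nth_overflow in Z1 by lia.
  set (T := fun (f : nat -> C) z => sumC m (fun k => f k * / (1 - RtoC (t k) * z))%C).
  assert (HT : forall f, exists l, Cder (T f) (RtoC 0) l).
  { intros f. apply (Cder_sumC m (fun k z => f k * / (1 - RtoC (t k) * z))%C). intros k _.
    eexists. apply Cder_mult; [apply Cder_const|].
    eapply Cder_ext; [|apply (Cder_comp (fun v => / (v - 0))%C (fun z => 1 + - RtoC (t k) * z)%C)].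
    - intros z; simpl. f_equal. ring.
    - apply Cder_inv. replace (1 + - t k * 0 - 0)%C with (RtoC 1) by ring.
      intros E. apply RtoC_inj in E. lra.
    - apply Cder_plus; [apply Cder_const|]. apply Cder_mult; [apply Cder_const|apply Cder_id]. }
  destruct (HT mu) as [lmu Hmu]. destruct (HT nu) as [lnu Hnu].
  destruct (Dp 0) as [dp Hp]. destruct (Dq 0) as [dq Hq]. destruct (D1 0) as [d1 H1].
  pose proof (eq_at_real (fun z => kap * F1 z)%C
    (fun z => kap * ((2 + z * z * T mu z) * Fp z) + (y + z * T nu z) * (e * Fq z))%C 0) as K.
  cbv beta in K. rewrite Zp, Zq, Z1 in K.
  replace (2 * kap + y * e)%C with (kap * ((2 + 0 * 0 * T mu 0) * 1) + (y + 0 * T nu 0) * (e *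
      1))%C by ring.
  rewrite <- K; [ring|..].
  - eexists. apply Cder_mult; [apply Cder_const|exact H1].
  - eexists. apply Cder_plus; apply Cder_mult.
    + apply Cder_const.
    + apply Cder_mult; [|exact Hp]. apply Cder_plus; [apply Cder_const|].
      apply Cder_mult; [|exact Hmu]. apply Cder_mult; apply Cder_id.
    + apply Cder_plus; [apply Cder_const|]. apply Cder_mult; [apply Cder_id|exact Hnu].
    + apply Cder_mult; [apply Cder_const|exact Hq].
  - intros z Hz.
    assert (Hz0 : z <> RtoC 0) by (intros E; apply Hz; rewrite E; reflexivity).
    assert (Hiz : snd (/ z)%C <> 0).
    { intros E. apply Hz. replace z with (/ / z)%C by (field; exact Hz0).
      destruct (/ z)%C as [a b]. simpl in E |- *. rewrite E. unfold Rdiv. ring. }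
    specialize (H (/ z)%C Hiz).
    assert (ET : forall f, sumC m (fun k => f k * / (/ z - RtoC (t k)))%C = (z * T f z)%C).
    { intros f. unfold T. rewrite <- sumC_scal. apply sumC_ext. intros k _.
      assert (Hn : (1 - t k * z)%C <> 0).
      { intros E. pose proof (f_equal fst E) as E2. pose proof (f_equal snd E) as E3. simpl in E2, E3.
        assert (t k * snd z = 0) by lra. apply Rmult_integral in H0. destruct H0; [|contradiction].
        rewrite H0 in E2. lra. }
      field. split; auto. }
    rewrite !ET in H.
    rewrite <- Ep, <- Eq, <- E1 by exact Hz0.
    replace (kap * (pevalC p1 (/ z) * z ^ S N))%C with (kap * pevalC p1 (/ z) * z ^ S N)%C by ring.
    rewrite H. simpl. field. exact Hz0.
Qed.

(** * The entries of the Lax matrix *)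

Lemma msum_entries m (F : nat -> M2) :
  msum m F = mkM2 (sumC m (fun k => e11 (F k))) (sumC m (fun k => e12 (F k)))
                  (sumC m (fun k => e21 (F k))) (sumC m (fun k => e22 (F k))).
Proof. induction m as [|m IH]; simpl; [reflexivity|]. rewrite IH. reflexivity. Qed.

Lemma Alax_entries m n c (x : R) y a b (z : C) :
  Alax m n c x y a b z = mkM2
    (z + x + sumC m (fun k => a k * b k * / (z - c k)))%C
    (y + sumC m (fun k => a k * y * / (z - c k)))%C
    (RtoC (-2) * (sumC m (fun k => a k * b k) + INR n) / y + sumC m (fun k => - (a k * (b k * b k)
        / y) * / (z - c k)))%C
    (- (z + x + sumC m (fun k => a k * b k * / (z - c k))))%C.
Proof.
  unfold Alax. rewrite msum_entries. unfold madd, mscale, Ainf, Ak, sigma3; cbn [e11 e12 e21 e22].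
  assert (K : forall f, sumC m (fun k => / (z - c k) * f k)%C = sumC m (fun k => f k * / (z - c
      k))%C).
  { intros f. apply sumC_ext. intros; ring. }
  rewrite !K.
  assert (EN : sumC m (fun k => - (a k * b k) * / (z - c k))%C = (- RtoC 1 * sumC m (fun k => a k *
      b k * / (z - c k)))%C).
  { rewrite <- sumC_scal. apply sumC_ext. intros; ring. }
  rewrite EN.
  replace (RtoC (-1)) with (- RtoC 1)%C by (rewrite <- RtoC_opp; reflexivity).
  f_equal; ring.
Qed.

(** Conjugation by [sigma1] exchanges the rows and the columns: the polynomial column of [Ymat]
    becomes the second column of [Phi], with P_{n-1} on top. *)
Lemma Phi_entries w P h n (x : R) (z : C) :
  let u := (z + x)%C in let Y := Ymat w P h n u in
  let g := cexp (- (u * u / 2))%C in let g' := cexp (- - (u * u / 2))%C in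
  let e := cexp (RtoC (x ^ 2 / 2)) in let e' := cexp (- RtoC (x ^ 2 / 2))%C in
  Phi w P h n x z = mkM2 (e' * e22 Y * g')%C (e' * e21 Y * g)%C (e * e12 Y * g')%C (e * e11 Y * g)%C.
Proof.
  intros. unfold Phi, mmul, exp_sigma3, sigma1. cbn [e11 e12 e21 e22]. fold u. fold Y.
  fold g g' e e'. f_equal; ring.
Qed.

Lemma Cder_shift (f : C -> C) (x : R) (z l : C) : Cder f (z + x)%C l -> Cder (fun v => f (v + x)%C)
    z l.
Proof.
  intros H. eapply Cder_val; [apply (Cder_comp f (fun v => (v + x)%C)); [exact H|]|].
  - apply Cder_plus; [apply Cder_id|apply Cder_const].
  - ring.
Qed.

Lemma RtoC_2 : RtoC 2 = (1 + 1)%C.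
Proof. rewrite <- RtoC_plus. reflexivity. Qed.

Lemma RtoC_neq (r : R) : r <> 0 -> RtoC r <> RtoC 0.
Proof. intros H E. apply H, RtoC_inj, E. Qed.

Lemma Cder_gauss_half (z : C) : Cder (fun u => cexp (- (u * u / 2)))%C z (- z * cexp (- (z * z /
    2)))%C.
Proof.
  eapply Cder_val; [apply (Cder_comp cexp (fun u => - (u * u / 2))%C); [apply Cder_cexp|]|].
  - eapply Cder_ext; [|apply Cder_mult; [apply (Cder_const (- / 2)%C)|apply Cder_mult; apply
      Cder_id]].
    intros v; simpl. unfold Cdiv. ring.
  - cbv beta. field.
Qed.

Lemma Cder_gauss_half_inv (z : C) : Cder (fun u => cexp (- - (u * u / 2)))%C z (z * cexp (- - (z *
    z / 2)))%C.
Proof.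
  eapply Cder_val; [apply (Cder_comp cexp (fun u => - - (u * u / 2))%C); [apply Cder_cexp|]|].
  - eapply Cder_ext; [|apply Cder_mult; [apply (Cder_const (/ 2)%C)|apply Cder_mult; apply Cder_id]].
    intros v; simpl. unfold Cdiv. ring.
  - cbv beta. field.
Qed.

(** At determinant 1 the inverse is the adjugate, so the entries of the coefficient matrix are
    determinants built from the solution and its derivative. *)
Lemma coefficient_of_unimodular_solution (f11 f12 f21 f22 d11 d12 d21 d22 A11 A12 A21 A22 : C) :
  (f11 * f22 - f12 * f21 = 1)%C ->
  (d11 = A11 * f11 + A12 * f21)%C -> (d12 = A11 * f12 + A12 * f22)%C ->
  (d21 = A21 * f11 + A22 * f21)%C -> (d22 = A21 * f12 + A22 * f22)%C ->
  (A11 = d11 * f22 - d12 * f21)%C /\ (A12 = d12 * f11 - d11 * f12)%C /\ (A21 = d21 * f22 - d22 *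
      f21)%C.
Proof.
  intros Hd -> -> -> ->. repeat split.
  - transitivity (A11 * (f11 * f22 - f12 * f21))%C; [rewrite Hd|]; ring.
  - transitivity (A12 * (f11 * f22 - f12 * f21))%C; [rewrite Hd|]; ring.
  - transitivity (A21 * (f11 * f22 - f12 * f21))%C; [rewrite Hd|]; ring.
Qed.

Lemma strictly_increasing_neq m (c : nat -> R) :
  (forall k, (1 <= k)%nat -> (k < m)%nat -> c k < c (S k)) ->
  forall j k, (1 <= j <= m)%nat -> (1 <= k <= m)%nat -> j <> k -> c j <> c k.
Proof.
  intros Hc.
  assert (K : forall j d, (1 <= j)%nat -> (j + S d <= m)%nat -> c j < c (j + S d)%nat).
  { intros j d Hj. induction d as [|d IH]; intros Hd.
    - rewrite Nat.add_1_r. apply Hc; lia.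
    - rewrite Nat.add_succ_r. eapply Rlt_trans; [apply IH; lia|]. apply Hc; lia. }
  intros j k Hj Hk Hne. destruct (Nat.lt_ge_cases j k).
  - pose proof (K j (k - j - 1)%nat ltac:(lia) ltac:(lia)) as H1.
    replace (j + S (k - j - 1))%nat with k in H1 by lia. lra.
  - pose proof (K k (j - k - 1)%nat ltac:(lia) ltac:(lia)) as H1.
    replace (k + S (j - k - 1))%nat with j in H1 by lia. lra.
Qed.

Lemma two_pi_i_neq_0 : two_pi_i <> RtoC 0.
Proof.
  unfold two_pi_i. intros E. apply (f_equal snd) in E. simpl in E. pose proof PI_RGT_0. lra.
Qed.

Section lax.
Variables (m : nat) (c wh : nat -> R) (N : nat) (x : R) (P : nat -> rpoly) (h : nat -> R)
  (y : C) (a b : nat -> C).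
Let w := weight m c wh x.
Hypothesis c_incr : forall k, (1 <= k)%nat -> (k < m)%nat -> c k < c (S k).
Hypothesis wh_ge_0 : forall k, (1 <= k <= m)%nat -> 0 <= wh k.
Hypothesis OP : is_OP_family w P h.
Hypothesis lax : forall z : C, snd z <> 0 ->
  mderiv (Phi w P h (S N) x) z (mmul (Alax m (S N) c x y a b z) (Phi w P h (S N) x z)).

Let p := pevalC (P N).
Let q := pevalC (P (S N)).
Let p1 := pevalC (dpoly (P N)).
Let q1 := pevalC (dpoly (P (S N))).
Let Dp := pevalC (assoc_poly w (P N)).
Let Dq := pevalC (assoc_poly w (P (S N))).
Let Dp1 := pevalC (dpoly (assoc_poly w (P N))).
Let Dq1 := pevalC (dpoly (assoc_poly w (P (S N)))).
Let C0 := resolvent m c wh x.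
Let C1 := dresolvent m c wh x (h O).
Let hN := RtoC (h N).
Let e := cexp (RtoC (x ^ 2 / 2)).
Let e' := cexp (- RtoC (x ^ 2 / 2))%C.
Let g := fun u => cexp (- (u * u / 2))%C.
Let g' := fun u => cexp (- - (u * u / 2))%C.

Lemma mass_0 : intR w (h O).
Proof.
  destruct OP as [HP [_ HI]]. eapply intR_ext; [|exact (HI O O)].
  intros s; simpl. destruct (HP O) as [L0 N0]. destruct (P O) as [|r [|]]; try discriminate.
  simpl in *. subst r. ring.
Qed.

Lemma hN_neq_0 : hN <> RtoC 0.
Proof. destruct OP as [_ [Hh _]]. apply RtoC_neq. specialize (Hh N). lra. Qed.

(** [N] stands for n - 1. In the first three equations [C0] has cancelled, so their right sides are
    [poles] times polynomials plus polynomials, ready for [residue_eq]. The fourth is the equation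
    for [Phi_12] with its exponential divided out; it feeds [leading_coefficient_eq]. *)
Lemma lax_equations (z : C) : snd z <> 0 ->
  let u := (z + x)%C in
  let A := Alax m (S N) c x y a b z in
  (e11 A = / hN * (Dq u * p1 u - q u * Dp1 u - u * (q u * Dp u + p u * Dq u) + 2 * h O * p u * q u
           - p u * q u * poles m c wh x u))%C /\
  (e12 A = - (e' * e' * two_pi_i / (hN * hN)) * (p u * p u * poles m c wh x u
           - 2 * h O * p u * p u + p u * Dp1 u - p1 u * Dp u + 2 * u * p u * Dp u))%C /\
  (e21 A = e * e / two_pi_i * (q u * q u * poles m c wh x u
           - 2 * h O * q u * q u + q u * Dq1 u - q1 u * Dq u + 2 * u * q u * Dq u))%C /\
  (- (e' * two_pi_i / hN) * p1 u =
     - (e' * two_pi_i / hN) * ((u + e11 A) * p u) + e12 A * (e * q u))%C.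
Proof.
  intros Hz u A.
  assert (Hh := hN_neq_0). assert (Ht := two_pi_i_neq_0).
  assert (Hu : forall v : C, snd v <> 0 -> snd (v + x)%C <> 0) by (intros v; simpl; rewrite
      Rplus_0_r; auto).
  assert (w0 : forall s, 0 <= w s) by (intros; apply weight_ge_0; auto).
  assert (HC0 : forall v : C, snd v <> 0 -> is_IntC (fun s => / (RtoC s - v) * RtoC (w s))%C (C0 v)).
  { intros v Hv. apply (is_IntC_resolvent m c wh x (h O)); auto. apply mass_0. }
  (* The entries of [Phi] with each Cauchy transform written as f C0 + D_f, an identity that is
     available off the line only. *)
  set (F := fun v => mkM2
    (e' * (- (/ hN * (p v * C0 v + Dp v))) * g' v)%C
    (e' * (- (two_pi_i / hN * p v)) * g v)%C
    (e * (/ two_pi_i * (q v * C0 v + Dq v)) * g' v)%C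
    (e * q v * g v)%C).
  assert (HF : forall v : C, snd v <> 0 -> Phi w P h (S N) x v = F (v + x)%C).
  { intros v Hv. rewrite Phi_entries. unfold Ymat. cbn [e11 e12 e21 e22].
    rewrite !(cauchy_pevalR w P h OP _ (v + x) (C0 (v + x)%C)) by auto. reflexivity. }
  assert (dC0 : Cder C0 u (C1 u)).
  { apply Cder_resolvent; [exact w0|apply mass_0|exact (Hu z Hz)]. }
  destruct (lax z Hz) as [L11 [L12 [L21 L22]]]. fold A in L11, L12, L21, L22.
  assert (D11 : Cder (fun v => e11 (F v)) u
    (e' * (- (/ hN * (p1 u * C0 u + p u * C1 u + Dp1 u + u * (p u * C0 u + Dp u)))) * g' u)%C).
  { eapply Cder_val.
    - apply Cder_mult; [|apply Cder_gauss_half_inv].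
      apply (Cder_ext (fun v => (- e' * / hN) * (p v * C0 v + Dp v))%C); [intros; ring|].
      apply Cder_mult; [apply Cder_const|]. apply Cder_plus; [|apply Cder_pevalC].
      apply Cder_mult; [apply Cder_pevalC|exact dC0].
    - cbv beta. fold p p1 Dp Dp1. fold (g' u). ring. }
  assert (D12 : Cder (fun v => e12 (F v)) u (e' * (- (two_pi_i / hN * (p1 u - u * p u))) * g u)%C).
  { eapply Cder_val.
    - apply Cder_mult; [|apply Cder_gauss_half].
      apply (Cder_ext (fun v => (- e' * (two_pi_i / hN)) * p v)%C); [intros; ring|].
      apply Cder_mult; [apply Cder_const|]. apply Cder_pevalC.
    - cbv beta. fold p p1. fold (g u). ring. }
  assert (D21 : Cder (fun v => e21 (F v)) u
    (e * (/ two_pi_i * (q1 u * C0 u + q u * C1 u + Dq1 u + u * (q u * C0 u + Dq u))) * g' u)%C).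
  { eapply Cder_val.
    - apply Cder_mult; [|apply Cder_gauss_half_inv].
      apply (Cder_ext (fun v => (e * / two_pi_i) * (q v * C0 v + Dq v))%C); [intros; ring|].
      apply Cder_mult; [apply Cder_const|]. apply Cder_plus; [|apply Cder_pevalC].
      apply Cder_mult; [apply Cder_pevalC|exact dC0].
    - cbv beta. fold q q1 Dq Dq1. fold (g' u). ring. }
  assert (D22 : Cder (fun v => e22 (F v)) u (e * (q1 u - u * q u) * g u)%C).
  { eapply Cder_val.
    - apply Cder_mult; [|apply Cder_gauss_half].
      apply Cder_mult; [apply Cder_const|]. apply Cder_pevalC.
    - cbv beta. fold q q1. fold (g u). ring. }
  apply Cder_shift in D11, D12, D21, D22.
  assert (E11 := Cder_unique _ _ _ _ (Cder_ext_off_real _ _ _ _ Hz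
    (fun v Hv => f_equal e11 (eq_sym (HF v Hv))) D11) L11).
  assert (E12 := Cder_unique _ _ _ _ (Cder_ext_off_real _ _ _ _ Hz
    (fun v Hv => f_equal e12 (eq_sym (HF v Hv))) D12) L12).
  assert (E21 := Cder_unique _ _ _ _ (Cder_ext_off_real _ _ _ _ Hz
    (fun v Hv => f_equal e21 (eq_sym (HF v Hv))) D21) L21).
  assert (E22 := Cder_unique _ _ _ _ (Cder_ext_off_real _ _ _ _ Hz
    (fun v Hv => f_equal e22 (eq_sym (HF v Hv))) D22) L22).
  clear D11 D12 D21 D22 L11 L12 L21 L22.
  rewrite (HF z Hz) in E11, E12, E21, E22. fold u in E11, E12, E21, E22.
  unfold mmul in E11, E12, E21, E22. cbn [e11 e12 e21 e22] in E11, E12, E21, E22.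
  assert (W := assoc_poly_wronskian w P h OP N u (Hu z Hz)).
  fold p q Dp Dq hN in W.
  assert (Eg : (g u * g' u = 1)%C) by apply cexp_opp_r.
  assert (Ee : (e * e' = 1)%C) by apply cexp_opp_r.
  assert (Det : (e11 (F u) * e22 (F u) - e12 (F u) * e21 (F u) = 1)%C).
  { cbn [e11 e12 e21 e22 F].
    transitivity ((p u * Dq u - q u * Dp u) / hN * (e * e') * (g u * g' u))%C.
    - field. auto.
    - rewrite W, Eg, Ee. field. auto. }
  destruct (coefficient_of_unimodular_solution _ _ _ _ _ _ _ _ _ _ _ _ Det E11 E12 E21 E22) as [S11
      [S12 S21]].
  assert (EC1 : C1 u = (poles m c wh x u - 2 * u * C0 u - 2 * h O)%C) by reflexivity.
  rewrite EC1 in S11, S12, S21.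
  split; [|split; [|split]].
  - rewrite S11. cbn [e11 e12 e21 e22 F].
    (* [field] does not know that these exponentials are mutually inverse; their product, equal to
       1, is inserted on the right so that both sides match. *)
    match goal with |- _ = ?r => transitivity (r * ((e * e') * (g u * g' u)))%C; [|rewrite Ee, Eg;
        ring] end.
    field. auto.
  - rewrite S12. cbn [e11 e12 e21 e22 F].
    match goal with |- _ = ?r => transitivity (r * (g u * g' u))%C; [|rewrite Eg; ring] end.
    field. auto.
  - rewrite S21. cbn [e11 e12 e21 e22 F].
    match goal with |- _ = ?r => transitivity (r * (g u * g' u))%C; [|rewrite Eg; ring] end.
    field. auto.
  - cbn [e11 e12 e21 e22 F] in E12.
    transitivity ((e' * - (two_pi_i / hN * (p1 u - u * p u)) * g u) * g' u - (e' * two_pi_i / hN *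
        (u * p u)) * (g u * g' u))%C.
    + transitivity (- (e' * two_pi_i / hN) * p1 u * (g u * g' u))%C; [rewrite Eg; ring|field; auto].
    + rewrite E12.
      match goal with |- _ = ?r => transitivity (r * (g u * g' u))%C; [|rewrite Eg; ring] end.
      field. auto.
Qed.
End lax.

(** * Entire functions and the proof of the theorem *)

Definition entire (f : C -> C) : Prop := forall z, exists l, Cder f z l.

Lemma entire_const (a : C) : entire (fun _ => a).
Proof. intros z. eexists. apply Cder_const. Qed.

Lemma entire_id : entire (fun z => z).
Proof. intros z. eexists. apply Cder_id. Qed.

Lemma entire_plus (f g : C -> C) : entire f -> entire g -> entire (fun z => f z + g z)%C.
Proof.
  intros Hf Hg z. destruct (Hf z), (Hg z). eexists. apply Cder_plus; eassumption.
Qed.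

Lemma entire_mult (f g : C -> C) : entire f -> entire g -> entire (fun z => f z * g z)%C.
Proof.
  intros Hf Hg z. destruct (Hf z), (Hg z). eexists. apply Cder_mult; eassumption.
Qed.

Lemma entire_opp (f : C -> C) : entire f -> entire (fun z => - f z)%C.
Proof.
  intros Hf z. destruct (entire_mult _ _ (entire_const (- RtoC 1)) Hf z) as [l Hl].
  exists l. eapply Cder_ext; [|exact Hl]. intros v; simpl. ring.
Qed.

Lemma entire_minus (f g : C -> C) : entire f -> entire g -> entire (fun z => f z - g z)%C.
Proof. intros Hf Hg. apply entire_plus; [exact Hf|apply entire_opp, Hg]. Qed.

Lemma entire_pevalC_shift (r : rpoly) (x : R) : entire (fun z => pevalC r (z + x)%C).
Proof. intros z. eexists. apply Cder_shift, Cder_pevalC. Qed.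

Lemma entire_at (f : C -> C) (z : C) : entire f -> exists l, Cder f z l.
Proof. intros H. apply H. Qed.

Ltac entire_tac :=
  repeat match goal with
  | |- entire (fun _ => ?a) => apply (entire_const a)
  | |- entire (fun z => z) => apply entire_id
  | |- entire (fun z => pevalC ?r (z + RtoC ?x)%C) => apply (entire_pevalC_shift r x)
  | |- entire (fun z => (@?f z + @?g z)%C) => apply (entire_plus f g)
  | |- entire (fun z => (@?f z - @?g z)%C) => apply (entire_minus f g)
  | |- entire (fun z => (@?f z * @?g z)%C) => apply (entire_mult f g)
  | |- entire (fun z => (- @?f z)%C) => apply (entire_opp f)
  end.

(** Since t_k - (z + x) = -(z - c_k), the residue of [poles] in the variable [z] is minus the
    jump. *)
Lemma poles_shift m c wh x (z : C) : snd z <> 0 ->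
  poles m c wh x (z + x)%C = sumC m (fun k => - RtoC (jump c wh x k) * / (z - c k))%C.
Proof.
  intros Hz. unfold poles. apply sumC_ext. intros k _. unfold tt. rewrite RtoC_plus.
  assert (Hn := Cminus_real_neq_0 z (c k) Hz).
  replace (c k + x - (z + x))%C with (c k - z)%C by ring. field. split; [|exact Hn].
  intros E. apply Hn. replace (c k - z)%C with (- (z - c k))%C by ring. rewrite E. ring.
Qed.

Theorem theorem5p4
  (m : nat) (c wh : nat -> R) (n : nat) (x : R)
  (P : nat -> rpoly) (h : nat -> R) (y : C) (a b : nat -> C) :
  (1 <= m)%nat ->
  c 1%nat = 0 ->
  (forall k, (1 <= k)%nat -> (k < m)%nat -> c k < c (S k)) ->
  (forall k, (1 <= k <= m)%nat -> 0 <= wh k) ->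
  (1 <= n)%nat ->
  is_OP_family (weight m c wh x) P h ->
  (* a_k, b_k, y are the scalars of the Lax matrix: d/dz Phi = A Phi off R *)
  y <> RtoC 0 ->
  (forall z : C, snd z <> 0 ->
     mderiv (Phi (weight m c wh x) P h n x) z
       (mmul (Alax m n c x y a b z) (Phi (weight m c wh x) P h n x z))) ->
  forall k, (1 <= k <= m)%nat ->
    let Rn := fun j => Rjk m c wh x P h n j in
    let rn := fun j => rnk m c wh x P h n j in
    let Ssum := Cplus (sumC m (fun j => RtoC (rn j))) (RtoC (INR n)) in
    RtoC (Rn k) = Cdiv (Cmult (a k) (Cmult (b k) (b k)))
                       (Cplus (sumC m (fun j => Cmult (a j) (b j))) (RtoC (INR n)))
    /\ RtoC (rn k) = Cmult (a k) (b k)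
    /\ (Rn k <> 0 -> rn k <> 0 -> Ssum <> RtoC 0 ->
          a k = Cdiv (RtoC (rn k ^ 2)) (Cmult (RtoC (Rn k)) Ssum)
          /\ b k = Cmult (RtoC (Rn k / rn k)) Ssum)
    /\ a k = Cmult (RtoC (1 / 2)) (RtoC (Rjk m c wh x P h (pred n) k)).
Proof.
  intros _ _ c_incr wh_ge_0 Hn OP y0 lax k Hk Rn rn Ssum.
  destruct n as [|N]; [lia|]. clear Hn. cbn [Init.Nat.pred] in *.
  pose proof (lax_equations m c wh N x P h y a b c_incr wh_ge_0 OP lax) as L.
  pose proof OP as [HP [Hh _]].
  assert (h0 := Hh N). assert (h1 := Hh (S N)).
  assert (hN0 : RtoC (h N) <> RtoC 0) by (apply RtoC_neq; lra).
  assert (hS0 : RtoC (h (S N)) <> RtoC 0) by (apply RtoC_neq; lra).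
  assert (t0 := two_pi_i_neq_0).
  set (e := cexp (RtoC (x ^ 2 / 2))) in *. set (e' := cexp (- RtoC (x ^ 2 / 2))%C) in *.
  assert (Ee : (e * e' = 1)%C) by apply cexp_opp_r.
  assert (e0 : e <> RtoC 0).
  { intros E. rewrite E in Ee. apply (RtoC_neq 1); [lra|]. rewrite <- Ee. ring. }
  assert (Ee' : e' = (/ e)%C). { transitivity (/ e * (e * e'))%C; [field; auto|rewrite Ee; ring]. }
  assert (c_neq : forall i j, (1 <= i <= m)%nat -> (1 <= j <= m)%nat -> i <> j -> c i <> c j)
    by (apply strictly_increasing_neq; auto).
  (* In the equation for [Phi_12] the factor 2 u collects one [u] from the diagonal of [A] and one
     from the derivative of the Gaussian; leading coefficients then give 2 kap + y e = 0 with kap =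
     - e' two_pi_i / h N. *)
  assert (Hy : y = (2 * e' * e' * two_pi_i / h N)%C).
  { pose proof (leading_coefficient_eq m (tt c x) N (P N) (dpoly (P N)) (P (S N))
      (- (e' * two_pi_i / h N))%C y e (fun j => a j * b j)%C (fun j => a j * y)%C) as K.
    destruct (HP N) as [L1 N1]. destruct (HP (S N)) as [L2 N2].
    specialize (K L1 N1 L2 N2).
    assert (Hl : (length (dpoly (P N)) <= S N)%nat).
    { unfold dpoly. rewrite length_dpoly1. destruct (P N); simpl in *; lia. }
    specialize (K Hl).
    assert (K' : (2 * - (e' * two_pi_i / h N) + y * e = 0)%C).
    { apply K. intros u Hu.
      destruct (L (u - x)%C) as [_ [_ [_ E]]].
      { simpl. lra. }
      assert (Eu : (u - x + x = u)%C) by ring.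
      rewrite Alax_entries in E. cbn [e11 e12] in E. rewrite !Eu in E.
      assert (ES : forall f, sumC m (fun j => f j * / (u - x - c j))%C = sumC m (fun j => f j * /
          (u - tt c x j))%C).
      { intros f. apply sumC_ext. intros j _. unfold tt. rewrite RtoC_plus. do 2 f_equal. ring. }
      rewrite !ES in E. rewrite E. rewrite RtoC_2. ring. }
    transitivity ((2 * - (e' * two_pi_i / h N) + y * e) * e' + 2 * e' * e' * two_pi_i / h N)%C.
    - rewrite Ee'. field. auto.
    - rewrite K'. ring. }
  set (t := tt c x k). set (j := jump c wh x k).
  (* Residue of the (1,1) entry: the minus sign of the coefficient - P_{n-1} P_n / h_{n-1} cancels
     that of the residue of [poles]. *)
  assert (Hr : forall i, (1 <= i <= m)%nat -> (a i * b i = RtoC (rn i))%C).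
  { intros i Hi. rewrite (residue_eq m c i (fun j => a j * b j)%C (fun j => - RtoC (jump c wh x j))%C
      (fun z => - (/ h N * (pevalC (P N) (z + x) * pevalC (P (S N)) (z + x))))%C
      (fun z => z + x)%C
      (fun z => / h N * (pevalC (assoc_poly (weight m c wh x) (P (S N))) (z + x) * pevalC (dpoly (P
          N)) (z + x)
        - pevalC (P (S N)) (z + x) * pevalC (dpoly (assoc_poly (weight m c wh x) (P N))) (z + x)
        - (z + x) * (pevalC (P (S N)) (z + x) * pevalC (assoc_poly (weight m c wh x) (P N)) (z + x)
                     + pevalC (P N) (z + x) * pevalC (assoc_poly (weight m c wh x) (P (S N))) (z + x))
        + 2 * h O * pevalC (P N) (z + x) * pevalC (P (S N)) (z + x)))%C Hi).
    - rewrite <- RtoC_plus, !pevalC_R. unfold rn, rnk. cbn [Init.Nat.pred]. fold (tt c x i).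
      unfold jump. rewrite RtoC_div by lra. rewrite !RtoC_mult. field. auto.
    - intros; apply c_neq; auto.
    - intros r; apply entire_at; entire_tac.
    - intros r; apply entire_at; entire_tac.
    - intros r; apply entire_at; entire_tac.
    - intros z Hz. destruct (L z Hz) as [E _]. rewrite Alax_entries in E. cbn [e11] in E.
      rewrite poles_shift in E by exact Hz. rewrite E. ring. }
  (* Residue of the (1,2) entry divided by [y]; the factor 1 / 2 is the inverse of the 2 in [y]. *)
  assert (Ha : (a k = RtoC (1 / 2) * RtoC (Rjk m c wh x P h N k))%C).
  { assert (E : (a k * y = - (e' * e' * two_pi_i / (h N * h N)) * (pevalC (P N) (c k + x) * pevalC
      (P N) (c k + x)) * - j)%C).
    { apply (residue_eq m c k (fun j => a j * y)%C (fun j => - RtoC (jump c wh x j))%C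
      (fun z => - (e' * e' * two_pi_i / (h N * h N)) * (pevalC (P N) (z + x) * pevalC (P N) (z +
          x)))%C
      (fun z => y)%C
      (fun z => - (e' * e' * two_pi_i / (h N * h N)) * (- (2 * h O * pevalC (P N) (z + x) * pevalC
          (P N) (z + x))
         + pevalC (P N) (z + x) * pevalC (dpoly (assoc_poly (weight m c wh x) (P N))) (z + x)
         - pevalC (dpoly (P N)) (z + x) * pevalC (assoc_poly (weight m c wh x) (P N)) (z + x)
         + 2 * (z + x) * pevalC (P N) (z + x) * pevalC (assoc_poly (weight m c wh x) (P N)) (z +
             x)))%C Hk).
      - intros; apply c_neq; auto.
      - intros r; apply entire_at; entire_tac.
      - intros r; apply entire_at; entire_tac.
      - intros r; apply entire_at; entire_tac.
      - intros z Hz. destruct (L z Hz) as [_ [E _]]. rewrite Alax_entries in E. cbn [e12] in E.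
        rewrite poles_shift in E by exact Hz. rewrite E. ring. }
    rewrite <- RtoC_plus, !pevalC_R in E. fold (tt c x k) in E. fold t in E.
    transitivity (a k * y / y)%C; [field; auto|]. rewrite E, Hy, Ee'.
    unfold Rjk. fold (jump c wh x k). fold j. fold t.
    rewrite !RtoC_div by lra. rewrite !RtoC_mult, RtoC_pow. field. repeat split; auto. }
  (* Residue of the (2,1) entry multiplied by [y]: the constants [e], [e'] and [two_pi_i] cancel,
     leaving 2 j P_n(t)^2 / h_{n-1}, and the division by h_n inside [Rn] accounts for the factor
     h_n. *)
  assert (Hab : (a k * (b k * b k) = RtoC (Rn k) * (2 * h (S N) / h N))%C).
  { assert (E : (- (a k * (b k * b k) / y) = e * e / two_pi_i * (pevalC (P (S N)) (c k + x) *
      pevalC (P (S N)) (c k + x)) * - j)%C).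
    { apply (residue_eq m c k (fun j => - (a j * (b j * b j) / y))%C (fun j => - RtoC (jump c wh x
        j))%C
      (fun z => e * e / two_pi_i * (pevalC (P (S N)) (z + x) * pevalC (P (S N)) (z + x)))%C
      (fun z => RtoC (-2) * (sumC m (fun k => a k * b k) + INR (S N)) / y)%C
      (fun z => e * e / two_pi_i * (- (2 * h O * pevalC (P (S N)) (z + x) * pevalC (P (S N)) (z + x))
         + pevalC (P (S N)) (z + x) * pevalC (dpoly (assoc_poly (weight m c wh x) (P (S N)))) (z + x)
         - pevalC (dpoly (P (S N))) (z + x) * pevalC (assoc_poly (weight m c wh x) (P (S N))) (z + x)
         + 2 * (z + x) * pevalC (P (S N)) (z + x) * pevalC (assoc_poly (weight m c wh x) (P (S N)))
             (z + x)))%C Hk).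
      - intros; apply c_neq; auto.
      - intros r; apply entire_at; entire_tac.
      - intros r; apply entire_at; entire_tac.
      - intros r; apply entire_at; entire_tac.
      - intros z Hz. destruct (L z Hz) as [_ [_ [E _]]]. rewrite Alax_entries in E. cbn [e21] in E.
        rewrite poles_shift in E by exact Hz. rewrite E. ring. }
    rewrite <- RtoC_plus, !pevalC_R in E. fold (tt c x k) in E. fold t in E.
    transitivity (- (- (a k * (b k * b k) / y)) * y)%C; [field; auto|]. rewrite E, Hy, Ee'.
    unfold Rn, Rjk. fold (jump c wh x k). fold j. fold t.
    rewrite !RtoC_div by lra. rewrite !RtoC_mult, RtoC_pow. field. repeat split; auto. }
  assert (ET : Ssum = (2 * h (S N) / h N)%C).
  { unfold Ssum, rn. rewrite Cplus_comm, (op_string_equation m c wh x P h N OP).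
    rewrite RtoC_div, RtoC_mult by lra. reflexivity. }
  assert (ES : sumC m (fun j => a j * b j)%C = sumC m (fun j => RtoC (rn j))).
  { apply sumC_ext. exact Hr. }
  rewrite ES. fold Ssum.
  assert (HRS : (a k * (b k * b k) = RtoC (Rn k) * Ssum)%C) by (rewrite ET; exact Hab).
  assert (Ssum0 : Ssum <> RtoC 0).
  { rewrite ET. intros E. apply hS0.
    transitivity (2 * h (S N) / h N * h N / 2)%C; [field; auto|rewrite E; field]. }
  split; [|split; [|split]].
  - rewrite HRS. field. exact Ssum0.
  - symmetry. apply Hr, Hk.
  - intros HR Hrk _. apply RtoC_neq in HR. apply RtoC_neq in Hrk as Hrk'.
    specialize (Hr k Hk).
    assert (ak0 : a k <> RtoC 0) by (intros E; apply Hrk'; rewrite <- Hr, E; ring).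
    assert (bk0 : b k <> RtoC 0) by (intros E; apply Hrk'; rewrite <- Hr, E; ring).
    split.
    + rewrite <- HRS, RtoC_pow, <- Hr. field. auto.
    + rewrite RtoC_div by exact Hrk.
      transitivity (RtoC (Rn k) * Ssum / rn k)%C; [|field; exact Hrk'].
      rewrite <- HRS, <- Hr. field. auto.
  - exact Ha.
Qed.
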